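(* Consider the nonstandard renewal risk model described in the context. Let $Y_i$, $i\ge1$, be ENOD random variables with common distribution $G\in\mathcal C$ and dominating coefficient $M_G$, and let $Z_i$, $i\ge1$, be ENOD random variables with common distribution $H$ and dominating coefficient $M_H$. If $\overline H(x)=o(\overline G(x))$ as $x\to\infty$, then the following two conclusions hold. (i) In Case 1, for each $\gamma>\mu_G$, $$\lim_{t\to\infty}\sup_{x\ge\gamma t}\left|\frac{P(R_0(t)>x)}{\mu_H^{-1}t\,\overline G(x-\mu_G\mu_H^{-1}t+ct)}-1\right|=0.$$ (ii) In Case 2, for each pair $\mu_G<\gamma<\Gamma<\infty$, $$\lim_{t\to\infty}\sup_{x\in[\gamma t,\Gamma t]}\left|\frac{P(R_0(t)>x)}{\mu_H^{-1}t\,\overline G(x-\mu_G\mu_H^{-1}t+ct)}-1\right|=0.$$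
   Context: Notation: for a distribution $F$, $\overline F=1-F$ is its tail, and for $y\in(0,\infty)$, $\overline{F_*}(y)=\liminf_{x\to\infty}\overline F(xy)/\overline F(x)$. The class $\mathcal C$ (consistently varying tails) consists of the distributions $F$ with $\lim_{y\downarrow 1}\overline{F_*}(y)=1$. Dependence: random variables $X_i$, $i\ge1$, are ENOD (extended negatively orthant dependent) with dominating coefficient $M>0$ if for all $n\ge 1$ and all real $x_1,\dots,x_n$, both $P(\bigcap_{i=1}^n\{X_i>x_i\})\le M\prod_{i=1}^nP(X_i>x_i)$ and $P(\bigcap_{i=1}^n\{X_i\le x_i\})\le M\prod_{i=1}^nP(X_i\le x_i)$. Renewal risk model: claim sizes $Y_i$, $i\ge1$, are random variables with common distribution $G$ on $[0,\infty)$ and mean $0<\mu_G<\infty$; inter-arrival times $Z_i$, $i\ge1$, are random variables with common distribution $H$ on $[0,\infty)$ and mean $0<\mu_H<\infty$; $\tau$ is a nonnegative random variable (random time). $N(t)=\sum_{n\ge1}\mathbf 1_{\{Z_1+\cdots+Z_n\le t\}}$, $\lambda(t)=EN(t)$, with $\inf\{t:0<\lambda(t)<\infty\}=0$. The positive constant $c$ satisfies the safety loading condition $\mu_G<c\mu_H$. The net loss process is $R_0(t)=\sum_{i=1}^{N(t)}(Y_i-cZ_i)$, $t\ge0$ (empty sum $=0$). Case 1 of the nonstandard model: $\{Y_i,i\ge1\}$, $\{Z_i,i\ge1\}$ and $\tau$ are independent of each other, but at least one of $\{Y_i\}$ and $\{Z_i\}$ is a dependent sequence. Case 2 of the nonstandard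 model: $\{(Y_i,Z_i),i\ge1\}$ and $\tau$ are independent of each other, but the sequences $\{Y_i,i\ge1\}$ and $\{Z_i,i\ge1\}$ are allowed to be arbitrarily dependent on each other. *)

(* Defs.v *)
From HB Require Import structures.
From mathcomp Require Import all_boot all_order all_algebra finmap.
From mathcomp Require Import all_classical all_reals all_analysis.

Set Implicit Arguments.
Unset Strict Implicit.
Unset Printing Implicit Defensive.

Import Order.TTheory GRing.Theory Num.Theory.
Import numFieldTopology.Exports numFieldNormedType.Exports.

Local Open Scope classical_set_scope.
Local Open Scope ring_scope.

(* A distribution is a probability measure F on the Borel sets of R. *)

Definition tail (R : realType) (F : probability R R) (x : R) : R :=
  1 - fine (F [set` `]-oo, x]]).

Definition tail_lower (R : realType) (F : probability R R) (y : R) : \bar R :=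
  limf_einf (fun x : R => (tail F (x * y) / tail F x)%:E) +oo.

(* As 0^-1 = 0, a tail that vanishes eventually has tail_lower F = 0, so
   membership forces tail F to be positive everywhere. *)
Definition consistently_varying (R : realType) (F : probability R R) : Prop :=
  tail_lower F y @[y --> 1^'+] --> 1%E.

Definition nonneg_supported (R : realType) (F : probability R R) : Prop :=
  F [set` `[0, +oo[] = 1%E.

Definition has_mean (R : realType) (F : probability R R) (mu : R) : Prop :=
  F.-integrable setT (fun x : R => x%:E) /\ (\int[F]_x x%:E = mu%:E)%E.

Section Dependence.
Context d (T : measurableType d) (R : realType) (P : probability T R).

(* Sequences are indexed from 0: X 0 stands for X_1. *)
Definition common_distribution (X : nat -> {RV P >-> R})
    (F : probability R R) : Prop :=
  forall i (A : set R), measurable A -> distribution P (X i) A = F A.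

Definition ENOD (X : nat -> {RV P >-> R}) (M : R) : Prop :=
  forall (n : nat) (x : nat -> R), (0 < n)%N ->
    (P (\bigcap_(i < n) [set w | (x i < X i w)%R]) <=
       M%:E * \prod_(i < n) P [set w | (x i < X i w)%R])%E /\
    (P (\bigcap_(i < n) [set w | (X i w <= x i)%R]) <=
       M%:E * \prod_(i < n) P [set w | (X i w <= x i)%R])%E.

Definition mutually_independent (I : choiceType) (F : I -> set (set T)) : Prop :=
  forall (J : {fset I}) (A : I -> set T),
    (forall j, j \in J -> F j (A j)) ->
    P (\bigcap_(j in [set` J]) A j) = (\prod_(j <- J) P (A j))%E.

Definition generated_sigma (I : Type) d' (U : measurableType d')
    (X : I -> T -> U) : set (set T) :=
  <<s \bigcup_i preimage_set_system setT (X i) measurable >>.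

Definition dependent_sequence (X : nat -> {RV P >-> R}) : Prop :=
  ~ mutually_independent
      (fun i => preimage_set_system setT (X i : T -> R) measurable).

Definition case1 (Y Z : nat -> {RV P >-> R}) (tau : {RV P >-> R}) : Prop :=
  mutually_independent (fun k : 'I_3 => nth set0
    [:: generated_sigma (fun i => Y i : T -> R);
        generated_sigma (fun i => Z i : T -> R);
        generated_sigma (fun _ : unit => tau : T -> R)] k) /\
  (dependent_sequence Y \/ dependent_sequence Z).

Definition case2 (Y Z : nat -> {RV P >-> R}) (tau : {RV P >-> R}) : Prop :=
  mutually_independent (fun k : 'I_2 => nth set0
    [:: generated_sigma (fun i (w : T) => (Y i w, Z i w));
        generated_sigma (fun _ : unit => tau : T -> R)] k).

End Dependence.

Section RenewalRisk.
Context d (T : measurableType d) (R : realType) (P : probability T R).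
Variables (Y Z : nat -> {RV P >-> R}) (c : R).

Definition renewal_count (t : R) (w : T) : \bar R :=
  (\sum_(1 <= n <oo) (\1_[set v | (\sum_(i < n) Z i v <= t)%R] w)%:E)%E.

Definition renewal_mean (t : R) : \bar R := (\int[P]_w renewal_count t w)%E.

(* On the event renewal_count t w = +oo the sum is taken to be empty; under the
   assumptions of the model this event is null. *)
Definition net_loss (t : R) (w : T) : R :=
  \sum_(i < Num.truncn (fine (renewal_count t w))) (Y i w - c * Z i w).

Definition deviation_ratio (G : probability R R) (muG muH t x : R) : R :=
  fine (P [set w | x < net_loss t w]) /
    (muH^-1 * t * tail G (x - muG * muH^-1 * t + c * t)).

End RenewalRisk.

(* Main.v *)
Require Import Defs.
From HB Require Import structures.
From mathcomp Require Import all_boot all_order all_algebra finmap.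
From mathcomp Require Import all_classical all_reals all_analysis.
From mathcomp Require Import measurable_realfun ring lra.

Set Implicit Arguments.
Unset Strict Implicit.
Unset Printing Implicit Defensive.

Import Order.TTheory GRing.Theory Num.Theory.
Import numFieldTopology.Exports numFieldNormedType.Exports.

Local Open Scope classical_set_scope.
Local Open Scope ring_scope.

(** Write [S n] and [W n] for the sums of the first [n] claims and interarrival
    times. By time [t] about [t / muH] renewals have occurred, and with [n]
    renewals the net loss is [S n - c * W n], where [W n] is close to [t]. So the
    net loss exceeds [x] roughly when a sum of [t / muH] claims exceeds
    [x + c * t], that is, exceeds its mean by [x + (c - muG / muH) * t]. Because
    tails are heavy this is caused by one big claim, whence the factor
    [t / muH * tail G (x + (c - muG / muH) * t)]; the safety loading makes the
    deviation at least linear in the number of claims.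

    Large deviations of sums. The upper bound ([large_deviation_upper]) separates
    the event that some summand exceeds [(1 - theta) * x] from the event that the
    sum of the summands truncated at that level is large. The latter is treated
    by Chernoff's inequality with a tilt adapted to the tail, for which a finite
    mean and a Potter bound suffice ([truncated_sum_negligible]). The lower bound
    ([large_deviation_lower]) is Bonferroni's inequality together with the
    exponentially light lower tail of sums of nonnegative variables
    ([truncated_sum_lower]). Consistent variation lets [theta] tend to [0] at the
    end. Orthant dependence bounds intersections of level sets: of two of them for
    Bonferroni's inequality, and in [step_moment_markov] of many, hence products of step functions, hence
    exponential moments on a grid, up to the dominating coefficient.

    From sums to the net loss. For a small [delta] the number of renewals is
    bracketed between [few_renewals] and [many_renewals], which are close to
    [(1 - delta) * t / muH] and [t / muH / (1 - delta)]. On the paths that respect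
    the brackets the net loss is compared with sums of a deterministic number of
    claims, to which the large deviations apply ([claims_upper], [claims_lower],
    [deviation_ratio_cvg]). The other paths are of two kinds. Interarrival times
    may be long, so that too few renewals occur: this is a large deviation of
    [W n], negligible since the tail of [H] is negligible against that of [G].
    Or some [W n] is too small for its [n] ([early_exponential]), which is
    exponentially unlikely in [n].

    Under arbitrary dependence the probabilities of these exceptional paths are
    compared directly with the rate, which is possible as long as [x] is at most
    a multiple of [t] ([loss_upper_comparable], [loss_lower_comparable]). When
    claims and interarrival times are independent, each exceptional event about
    the interarrival times factors off, and what multiplies it is the
    probability that a sum of claims exceeds [x], which is controlled for every
    [x] ([loss_upper_independent], [loss_lower_independent]). *)

(** * Real-valued probabilities and tails *)

Definition prob d (T : measurableType d) (R : realType)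
  (P : probability T R) (A : set T) : R := fine (P A).

Section Probabilities.
Context d (T : measurableType d) (R : realType) (P : probability T R).
Local Notation pr := (prob P).
Implicit Types A B : set T.

Lemma probE A : measurable A -> P A = (pr A)%:E.
Proof. by move=> mA; rewrite /prob fineK// fin_num_measure. Qed.

Lemma prob_ge0 A : 0 <= pr A.
Proof. exact/fine_ge0/measure_ge0. Qed.

Lemma prob_le1 A : measurable A -> pr A <= 1.
Proof. by move=> mA; rewrite -lee_fin -probE// probability_le1. Qed.

Lemma le_prob A B : measurable A -> measurable B -> A `<=` B -> pr A <= pr B.
Proof.
by move=> mA mB AB; rewrite -lee_fin -!probE// le_measure ?inE.
Qed.

Lemma probU_le A B : measurable A -> measurable B ->
  pr (A `|` B) <= pr A + pr B.
Proof.
move=> mA mB; rewrite -lee_fin EFinD -!probE ?measureU2//.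
exact: measurableU.
Qed.

Lemma prob_le_setD A B : measurable A -> measurable B ->
  pr A <= pr (A `&` B) + pr (A `\` B).
Proof.
move=> mA mB.
have mI := measurableI _ _ mA mB; have mD := measurableD mA mB.
apply: le_trans (probU_le mI mD); apply: le_prob => //.
  exact: measurableU.
by rewrite setUIDK.
Qed.

Lemma prob_bigcup_ord_le n (A : nat -> set T) : (forall i, measurable (A i)) ->
  pr (\bigcup_(i < n) A i) <= \sum_(i < n) pr (A i).
Proof.
move=> mA; elim: n => [|n IHn].
  by rewrite big_ord0 bigcup_mkord big_ord0 /prob measure0.
rewrite big_ord_recr /= bigcup_mkord big_ord_recr /= -bigcup_mkord.
apply: le_trans (probU_le _ _) _ => //; last by rewrite lerD2r.
exact: bigcup_measurable.
Qed.

(** Boole's inequality against a geometric series: the form in which all the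
    large-deviation estimates over an unbounded number of summands are added up. *)
Lemma prob_bigcup_geometric (A : nat -> set T) (B q : R) m :
  (forall i, measurable (A i)) -> 0 <= B -> 0 <= q < 1 ->
  (forall i, pr (A (m + i)%N) <= B * q ^+ i) ->
  pr (\bigcup_i A (m + i)%N) <= B / (1 - q).
Proof.
move=> mA B0 /andP[q0 q1] hA.
have mU : measurable (\bigcup_i A (m + i)%N) by exact: bigcup_measurable.
rewrite -lee_fin -(probE mU).
apply: le_trans (@measure_sigma_subadditive _ _ _ P _ (fun i => A (m + i)%N) _ _ _) _ => //.
apply: lime_le.
  by apply: is_cvg_nneseries => i _ _; exact: measure_ge0.
apply: nearW => n; rewrite big_mkord.
apply: le_trans (_ : ((\sum_(i < n) B * q ^+ i)%:E <= _)%E).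
  rewrite -sumEFin; apply: lee_sum => i _.
  by have := hA i; rewrite -lee_fin -(probE (mA _)).
rewrite lee_fin -mulr_sumr ler_wpM2l//.
have q1' : 0 < 1 - q by rewrite subr_gt0.
rewrite -[leRHS]mul1r ler_pdivlMr//.
have -> : (\sum_(i < n) q ^+ i) * (1 - q) = 1 - q ^+ n.
  by rewrite mulrC -[in RHS](expr1n _ n) subrXX; congr (_ * _);
    apply: eq_bigr => i _; rewrite expr1n mul1r.
by rewrite gerBl exprn_ge0.
Qed.

Lemma Rintegral_step (I : Type) (r : seq I) (a : I -> R) (A : I -> set T) D :
  measurable D -> (forall i, measurable (A i)) ->
  P.-integrable D (EFin \o (fun w => \sum_(i <- r) a i * \1_(A i) w)) /\
  Rintegral P D (fun w => \sum_(i <- r) a i * \1_(A i) w) =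
    \sum_(i <- r) a i * pr (A i `&` D).
Proof.
move=> mD mA; elim: r => [|j s [IH1 IH2]].
  have -> : (fun w => \sum_(i <- [::]) a i * \1_(A i) w) = cst 0.
    by apply/funext => y; rewrite big_nil.
  split; first exact: finite_measure_integrable_cst.
  by rewrite big_nil Rintegral_cst// mul0r.
have hf : (fun y => \sum_(i <- j :: s) a i * \1_(A i) y) =
    (fun y => a j * \1_(A j) y) \+ (fun y => \sum_(i <- s) a i * \1_(A i) y).
  by apply/funext => y; rewrite big_cons.
have sj0 : P.-integrable D (EFin \o \1_(A j)).
  by apply: integrableS (integrable_indic P (mA j)).
have sj : P.-integrable D (EFin \o (fun y => a j * \1_(A j) y)).
  by have := integrableZl mD (a j) sj0; apply: eq_integrable.
split.
  rewrite hf; have := integrableD mD sj IH1.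
  by apply: eq_integrable.
rewrite hf RintegralD// IH2 big_cons RintegralZl//.
by rewrite {1}/Rintegral integral_indic.
Qed.

End Probabilities.

Section Tails.
Context (R : realType) (F : probability R R).

Lemma tailE x : tail F x = prob F [set` `]x, +oo[].
Proof.
rewrite /tail /prob; have := probability_setC F (measurable_itv `]-oo, x]).
rewrite setCitvl => ->.
by rewrite fineB// ?fin_num_measure.
Qed.

Lemma tail_ge0 x : 0 <= tail F x.
Proof. by rewrite tailE prob_ge0. Qed.

Lemma tail_le1 x : tail F x <= 1.
Proof. by rewrite tailE prob_le1. Qed.

Lemma le_tail x y : x <= y -> tail F y <= tail F x.
Proof.
move=> xy; rewrite !tailE; apply: le_prob => //.
by apply: subset_itvr; rewrite bnd_simp.
Qed.

End Tails.

(** * Consistently varying tails *)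

Section RegularVariation.
Context (R : realType) (G : probability R R).
Hypothesis CG : consistently_varying G.

(** The lower limit at a single scale close to [1] already gives a one-step
    comparison of the tail, which every later estimate iterates or rescales. *)
Lemma consistently_varying_lower (e : R) : 0 < e ->
  exists rho z0 : R, [/\ 1 < rho, 0 < z0 &
    forall z, z0 <= z -> tail G z < (1 + e) * tail G (rho * z)].
Proof.
move=> e0.
have e1 : (1 + e)^-1 < 1 by rewrite invf_lt1; lra.
have /CG : nbhs 1%E [set y : \bar R | ((1 + e)^-1%:E < y)%E].
  exact: open_ereal_gt_ereal.
move=> [r /= r0 hr].
have := hr (1 + r / 2).
rewrite /= opprD addrA subrr sub0r normrN gtr0_norm; last by rewrite divr_gt0.
have r2 : r / 2 < r by rewrite ltr_pdivrMr// mulr_natr mulr2n ltrDl.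
move=> /(_ r2); rewrite ltrDl divr_gt0// => /(_ isT).
rewrite /tail_lower limf_einfE => /ereal_sup_gt[_ [V [M [_ hM]] <-]] hV.
exists (1 + r / 2), (Num.max 1 (M + 1)); split; first by rewrite ltrDl divr_gt0.
  by rewrite lt_max ltr01.
move=> z; rewrite ge_max => /andP[z1 zM].
have Vz : V z by apply: hM; apply: lt_le_trans zM; rewrite ltrDl.
have : ((1 + e)^-1%:E < (tail G (z * (1 + r / 2)) / tail G z)%:E)%E.
  by apply: lt_le_trans hV _; apply: ereal_inf_lbound; exists z.
rewrite lte_fin => h.
have G0 : 0 < tail G z.
  rewrite lt_neqAle tail_ge0 andbT eq_sym; apply/eqP => Gz; move: h.
  by rewrite Gz invr0 mulr0 ltNge invr_ge0 addr_ge0// ltW.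
move: h; rewrite ltr_pdivlMr// mulrC -ltr_pdivlMr ?invr_gt0 ?addr_gt0// invrK.
by rewrite mulrC [z * _]mulrC.
Qed.

(** The one-step comparison is strict, so no tail beyond the threshold vanishes. *)
Lemma consistently_varying_gt0 x : 0 < tail G x.
Proof.
have [rho [z0 [rho1 z00 h]]] := consistently_varying_lower ltr01.
have := h (Num.max x z0); rewrite le_max lexx orbT => /(_ isT) hm.
have : 0 < tail G (rho * Num.max x z0).
  have := le_lt_trans (tail_ge0 G _) hm.
  by rewrite pmulr_rgt0// addr_gt0.
move=> /lt_le_trans; apply; apply: le_tail.
apply: le_trans (_ : Num.max x z0 <= _); first by rewrite le_max lexx.
rewrite ler_peMl ?ltW// lt_max z00 orbT//.
Qed.

(** Iterating the one-step comparison reaches the scale [2]; below the threshold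
    the tail is caught between a positive constant and [1], which a larger power
    of [2] absorbs. *)
Lemma tail_doubling : exists p : nat, forall x, 0 <= x ->
  tail G x <= 2 ^+ p * tail G (2 * x).
Proof.
have [rho [z0 [rho1 z00 h]]] := consistently_varying_lower ltr01.
have [k hk] : exists k, 2 <= rho ^+ k.
  exists (Num.bound (2 / (rho - 1))).
  set k := Num.bound _.
  have hk : 2 / (rho - 1) < k%:R.
    by apply: archi_boundP; rewrite divr_ge0// subr_ge0 ltW.
  have : 1 + k%:R * (rho - 1) <= rho ^+ k.
    clear hk; elim: k => [|k IH]; first by rewrite mul0r addr0 expr0.
    rewrite exprS; apply: le_trans (ler_wpM2l _ IH); last lra.
    rewrite -natr1; have := mulr_ge0 (ler0n R k) (sqr_ge0 (rho - 1)).
    by rewrite expr2; lra.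
  apply: le_trans; move: hk; rewrite ltr_pdivrMr ?subr_gt0//; lra.
have hz z : z0 <= z -> tail G z <= 2 ^+ k * tail G (2 * z).
  move=> zz.
  have z_ge0 : 0 <= z by lra.
  have iter j : tail G z <= 2 ^+ j * tail G (rho ^+ j * z).
    elim: j => [|j IH]; first by rewrite !expr0 !mul1r.
    apply: le_trans IH _; rewrite exprSr -mulrA ler_wpM2l ?exprn_ge0//.
    have := h (rho ^+ j * z).
    rewrite exprS -mulrA => /(_ _)/ltW; apply.
    apply: le_trans zz _; rewrite ler_peMl// exprn_ege1// ltW//.
  apply: le_trans (iter k) _; rewrite ler_wpM2l ?exprn_ge0// le_tail//.
  by rewrite ler_wpM2r.
have Gz0 := consistently_varying_gt0 (2 * z0).
have [m hm] : exists m : nat, (tail G (2 * z0))^-1 <= 2 ^+ m.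
  exists (Num.bound (tail G (2 * z0))^-1).
  set m := Num.bound _.
  have : (tail G (2 * z0))^-1 < m%:R by apply: archi_boundP; rewrite invr_ge0 ltW.
  move=> /ltW/le_trans; apply; rewrite -natrX ler_nat ltnW// ltn_expl//.
exists (k + m)%N => x x0; rewrite exprD.
have [zx|xz] := leP z0 x.
  apply: le_trans (hz _ zx) _; rewrite ler_wpM2r ?tail_ge0// ler_peMr ?exprn_ge0//.
  by rewrite exprn_ege1// ler1n.
apply: le_trans (tail_le1 _ _) _.
apply: le_trans (_ : (tail G (2 * z0))^-1 * tail G (2 * z0) <= _).
  by rewrite mulVf// gt_eqF.
apply: ler_pM; rewrite ?invr_ge0 ?tail_ge0//; last first.
  by apply: le_tail; rewrite ler_pM2l// ltW.
by apply: le_trans hm _; rewrite ler_peMl ?exprn_ge0// exprn_ege1// ler1n.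
Qed.

(** A Potter-type bound: tails of consistent variation decay at most
    polynomially, uniformly down to the origin. *)
Lemma tail_potter : exists p : nat, forall L x, 1 <= L -> 0 <= x ->
  tail G x <= (2 * L) ^+ p * tail G (L * x).
Proof.
have [p hp] := tail_doubling; exists p => L x L1 x0.
have iter k : tail G x <= (2 ^+ k) ^+ p * tail G (2 ^+ k * x).
  elim: k => [|k IH]; first by rewrite !expr0 expr1n !mul1r.
  apply: le_trans IH _; rewrite [_ ^+ k.+1]exprSr exprMn -!mulrA.
  rewrite ler_wpM2l ?exprn_ge0//.
  have := hp (2 ^+ k * x); rewrite mulrCA; apply.
  by rewrite mulr_ge0// exprn_ge0.
have ex : exists k, L <= 2 ^+ k.
  exists (Num.bound L); apply: le_trans (_ : (Num.bound L)%:R <= _).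
    by rewrite ltW// archi_boundP//; lra.
  by rewrite -natrX ler_nat ltnW// ltn_expl.
have [k Lk kmin] := ex_minnP ex.
have k2 : 2 ^+ k <= 2 * L.
  case: k Lk kmin => [|k] Lk kmin; first by rewrite expr0; lra.
  rewrite exprS ler_pM2l// ltW// ltNge; apply/negP => /kmin.
  by rewrite ltnn.
apply: le_trans (iter k) _.
apply: ler_pM; rewrite ?exprn_ge0 ?tail_ge0//.
  by rewrite lerXn2r// nnegrE; [rewrite exprn_ge0|lra].
by apply: le_tail; rewrite ler_wpM2r.
Qed.

End RegularVariation.

(** * Nonnegative laws with a finite mean *)

Definition truncated_mean (R : realType) (F : probability R R) (K : R) : R :=
  Rintegral F [set` `[0, +oo[] (fun x => Num.min x K).

Section NonnegativeLaw.
Context (R : realType) (F : probability R R) (mu : R).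
Hypothesis Fpos : nonneg_supported F.
Hypothesis Fmean : has_mean F mu.

Local Notation Rp := [set` `[(0 : R), +oo[].
Local Notation E := (Rintegral F Rp).
Local Notation intg f := (F.-integrable Rp (EFin \o f)).

Let mRp : measurable Rp. Proof. exact: measurable_itv. Qed.

Lemma nonneg_null : F (~` Rp) = 0%E.
Proof.
rewrite probability_setC//.
by rewrite (Fpos : F Rp = 1%E) subee.
Qed.

Lemma prob_setI_nonneg A : measurable A -> prob F (A `&` Rp) = prob F A.
Proof.
move=> mA; apply/eqP; rewrite eq_le; apply/andP; split.
  by apply: le_prob => //; exact: measurableI.
apply: le_trans (prob_le_setD F mA mRp) _; rewrite gerDl.
have -> : prob F (A `\` Rp) = 0; last by [].
apply: le_anti; rewrite prob_ge0 andbT.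
apply: le_trans (_ : prob F (~` Rp) <= _).
  apply: le_prob; [exact: measurableD|exact: measurableC|].
  by rewrite setDE; exact: subIsetr.
by rewrite /prob nonneg_null.
Qed.

Lemma intg_id : intg id.
Proof. by apply: integrableS Fmean.1. Qed.

Lemma intg_cst r : intg (cst r).
Proof. exact: finite_measure_integrable_cst. Qed.

Lemma intg_indic A : measurable A -> intg \1_A.
Proof. by move=> mA; apply: integrableS (integrable_indic F mA). Qed.

Lemma intg_min K : 0 <= K -> intg (fun x => Num.min x K).
Proof.
move=> K0; apply: le_integrable intg_id => //.
  apply/measurable_EFinP; apply: measurable_minr => //.
move=> x /=; rewrite in_itv/= andbT => x0.
by rewrite lee_fin !ger0_norm// ?le_min ?x0// ge_min lexx.
Qed.

Lemma E_id : E id = mu.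
Proof.
rewrite /Rintegral; suff -> : (\int[F]_(x in Rp) x%:E = mu%:E)%E by [].
rewrite -Fmean.2 [RHS](@negligible_integral _ _ _ _ _ (~` Rp))//.
- by rewrite setTD setCK.
- exact: measurableC.
- exact: Fmean.1.
- exact: nonneg_null.
Qed.

Lemma E_indic A : measurable A -> E \1_A = prob F A.
Proof.
move=> mA; rewrite /Rintegral integral_indic//.
by rewrite -[RHS]prob_setI_nonneg// /prob.
Qed.

Lemma intgD f g : intg f -> intg g -> intg (f \+ g).
Proof.
by move=> sf sg; have := integrableD mRp sf sg; apply: eq_integrable.
Qed.

Lemma intgZ r f : intg f -> intg (fun x => r * f x).
Proof.
by move=> sf; have := integrableZl mRp r sf; apply: eq_integrable.
Qed.

Lemma E_cst r : E (fun=> r) = r.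
Proof.
have F1 : prob F Rp = 1 by rewrite /prob (Fpos : F _ = 1%E).
by rewrite Rintegral_cst// [X in _ * X]F1 mulr1.
Qed.

Lemma intg_affine a b f : intg f -> intg (fun y => a + b * f y).
Proof.
by move=> sf; apply: (@intgD (fun=> a)) (intgZ b sf); exact: intg_cst.
Qed.

Lemma E_affine a b f : intg f -> E (fun y => a + b * f y) = a + b * E f.
Proof.
move=> sf; rewrite RintegralD//; last exact: intgZ.
  by rewrite RintegralZl// E_cst.
exact: (intg_cst a).
Qed.

(** How a pointwise bound on a step function of a variable is turned into a bound
    on the corresponding weighted sum of probabilities. *)
Lemma le_mean_step J (a : 'I_J -> R) (A : 'I_J -> set R) (g : R -> R) :
  (forall j, measurable (A j)) -> intg g ->
  (forall y, 0 <= y -> \sum_j a j * \1_(A j) y <= g y) ->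
  \sum_j a j * prob F (A j) <= E g.
Proof.
move=> mA sg hg.
have [s1 s2] := Rintegral_step F (index_enum 'I_J) a mRp mA.
under eq_bigr do rewrite -prob_setI_nonneg//.
rewrite -s2; apply: le_Rintegral => // y /=.
by rewrite in_itv/= andbT => /hg.
Qed.

Lemma truncated_mean_cvg (e : R) : 0 < e ->
  exists K0 : R, 0 < K0 /\ forall K, K0 <= K -> mu - e < truncated_mean F K.
Proof.
move=> e0.
have cv : (\int[F]_(x in Rp) (Num.min x n%:R)%:E @[n --> \oo] --> mu%:E)%E.
  rewrite -E_id /Rintegral fineK; last first.
    by apply: integrable_fin_num => //; exact: intg_id.
  have -> : (\int[F]_(x in Rp) (id x)%:E =
      \int[F]_(x in Rp) limn (fun n => (Num.min x n%:R)%:E))%E.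
    apply: eq_integral => x; rewrite inE /= in_itv/= andbT => x0.
    apply/esym/cvg_lim => //; apply: cvg_near_cst.
    exists (Num.bound x) => // n /= hn.
    congr EFin; apply/min_idPl; apply: ltW; apply: lt_le_trans (archi_boundP x0) _.
    by rewrite ler_nat.
  apply: (@cvg_monotone_convergence _ _ _ F Rp mRp (fun n x => (Num.min x n%:R)%:E)).
  - move=> n; apply/measurable_EFinP; exact: measurable_minr.
  - by move=> n x; rewrite /= in_itv/= andbT => x0; rewrite lee_fin le_min x0 ler0n.
  - move=> x _ m n mn; rewrite lee_fin le_min !ge_min lexx/=.
    by rewrite ler_nat mn orbT.
have : nbhs mu%:E [set y : \bar R | ((mu - e)%:E < y)%E].
  by apply: open_ereal_gt_ereal => /=; rewrite lte_fin ltrBlDr ltrDl.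
move=> /cv [N _ hN].
exists (N.+1%:R); split => // K NK.
have K0 : 0 <= K by apply: le_trans NK.
have := hN N.+1 (leqnSn _) => /=.
have -> : (\int[F]_(x in Rp) (Num.min x N.+1%:R)%:E)%E =
    (truncated_mean F N.+1%:R)%:E.
  by rewrite /truncated_mean /Rintegral fineK//;
    apply: integrable_fin_num => //; exact: intg_min.
rewrite lte_fin => /lt_le_trans; apply.
apply: le_Rintegral => //; [exact: intg_min|exact: intg_min|].
by move=> x _; rewrite le_min !ge_min lexx/= NK orbT.
Qed.

(** Truncation at [x / 2] costs every point above [x] at least [x / 2], while the
    truncated means converge to the finite mean. *)
Lemma mul_tail_cvg0 (e : R) : 0 < e ->
  exists x0 : R, 0 < x0 /\ forall x, x0 <= x -> x * tail F x <= e.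
Proof.
move=> e0; have [K0 [K00 hK]] := truncated_mean_cvg (divr_gt0 e0 (ltr0Sn R 1)).
exists (2 * K0); split; first by rewrite mulr_gt0.
move=> x hx; have x20 : 0 <= x / 2 by lra.
have mB : measurable [set` `]x, +oo[ : interval R] by [].
have Kx : K0 <= x / 2 by lra.
suff : x / 2 * tail F x <= mu - truncated_mean F (x / 2).
  by have := hK _ Kx; lra.
rewrite tailE -E_indic// -RintegralZl//; last exact: intg_indic.
rewrite -E_id -RintegralB//; [|exact: intg_id|exact: intg_min].
apply: le_Rintegral => //.
- by apply: intgZ; exact: intg_indic.
- have := intgD intg_id (intgZ (-1) (intg_min x20)).
  by apply: eq_integrable => // y _ /=; rewrite mulN1r.
move=> y; rewrite /= in_itv/= andbT => y0.
have [xy|yx] := ltP x y.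
  rewrite mem_set/= ?in_itv/= ?andbT//.
  have -> : Num.min y (x / 2) = x / 2 by apply/min_idPr; lra.
  lra.
rewrite memNset/= ?in_itv/= ?andbT; last by apply/negP; rewrite -leNgt.
by rewrite mulr0 subr_ge0 ge_min lexx.
Qed.

Lemma tail_cvg0 (e : R) : 0 < e -> exists2 x0 : R, 0 < x0 & tail F x0 <= e.
Proof.
move=> e0; have [x0 [x00 h]] := mul_tail_cvg0 e0.
exists (Num.max 1 x0); first by rewrite lt_max ltr01.
have := h (Num.max 1 x0); rewrite le_max lexx orbT => /(_ isT).
apply: le_trans; rewrite ler_peMl ?tail_ge0// le_max lexx//.
Qed.

End NonnegativeLaw.

(** * Exponential inequalities under extended negative orthant dependence *)

Section StepMoments.
Context d (T : measurableType d) (R : realType) (P : probability T R).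
Local Notation pr := (prob P).

(** Orthant dependence only bounds probabilities of intersections of level sets.
    Expanding a product of sums of weighted indicators into a sum of products
    turns this into a bound on expectations of products of step functions, hence
    into a Markov inequality with the product moment of independent variables. *)
Lemma step_moment_markov n J (A : nat -> 'I_J -> set T) (a p : 'I_J -> R)
    (M r : R) (B : set T) :
  (forall i j, measurable (A i j)) -> measurable B -> (forall j, 0 <= a j) ->
  (forall f : {ffun 'I_n -> 'I_J},
     pr [set w | forall i : 'I_n, A i (f i) w] <= M * \prod_i p (f i)) ->
  (forall w, B w -> r <= \prod_(i < n) \sum_j a j * \1_(A i j) w) ->
  r * pr B <= M * (\sum_j a j * p j) ^+ n.
Proof.
move=> mA mB a0 hp hB.
pose C (f : {ffun 'I_n -> 'I_J}) := [set w | forall i : 'I_n, A i (f i) w].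
have mC f : measurable (C f).
  have -> : C f = \bigcap_(i in [set: 'I_n]) A i (f i).
    by apply/seteqP; split => [w Cw i _|w Cw i]; exact: Cw.
  exact: fin_bigcap_measurable.
pose c (f : {ffun 'I_n -> 'I_J}) := \prod_i a (f i).
have prodE w : \prod_(i < n) \sum_j a j * \1_(A i j) w =
    \sum_f c f * \1_(C f) w.
  rewrite bigA_distr_bigA; apply: eq_bigr => f _.
  rewrite big_split/=; congr (_ * _).
  rewrite indicE; have [/set_mem Cw|Cw] := boolP (w \in C f).
    by rewrite big1// => i _; rewrite indicE mem_set//; exact: Cw.
  have /existsNP[i nA] : ~ forall i : 'I_n, A i (f i) w.
    by move=> h; move/negP: Cw; apply; rewrite inE.
  by rewrite (bigD1 i)//= indicE memNset ?mul0r.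
have [sB eB] := @Rintegral_step _ _ _ P unit [:: tt] (fun=> r) (fun=> B) setT
  measurableT (fun=> mB).
have [sC eC] := Rintegral_step P (index_enum _) c measurableT mC.
have : r * pr B <= \sum_f c f * pr (C f).
  under eq_bigr do rewrite -(setIT (C _)).
  rewrite -eC; move: eB; rewrite big_seq1 setIT => <-.
  apply: le_Rintegral => // w _; rewrite big_seq1 indicE.
  have [/set_mem Bw|Bw] := boolP (w \in B).
    by rewrite mulr1 -prodE; exact: hB.
  rewrite mulr0; apply: sumr_ge0 => f _; apply: mulr_ge0 => //.
  by apply: prodr_ge0.
move=> /le_trans; apply.
have -> : (\sum_j a j * p j) ^+ n = \sum_f c f * \prod_i p (f i).
  rewrite -[X in _ ^+ X]card_ord -prodr_const.
  rewrite bigA_distr_bigA; apply: eq_bigr => f _.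
  by rewrite big_split.
rewrite mulr_sumr; apply: ler_sum => f _; rewrite mulrCA.
by apply: ler_wpM2l; [exact: prodr_ge0|exact: hp].
Qed.

End StepMoments.

Section ExponentialSteps.
Context (R : realType).
Implicit Types s h y : R.

(** A step function that dominates [expR (s * Num.min y (J * h))] on the grid of
    mesh [h]. Only indicators of half-lines [x < y] are at hand, so the constant
    [1] is written as the indicator of [-1 < y], the variables being nonnegative. *)
Definition up_threshold h (j : nat) : R := if j is k.+1 then k%:R * h else -1.

Definition up_weight s h (j : nat) : R :=
  if j is k.+1 then expR (s * (k.+1%:R * h)) - expR (s * (k%:R * h)) else 1.

Lemma up_weight_ge0 s h j : 0 <= s -> 0 <= h -> 0 <= up_weight s h j.
Proof.
move=> s0 h0; case: j => [|k]//=.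
by rewrite subr_ge0 ler_expR ler_wpM2l// ler_wpM2r// ler_nat.
Qed.

Lemma up_steps s h y J : 0 <= s -> 0 <= h -> 0 <= y ->
  expR (s * Num.min y (J%:R * h)) <=
    \sum_(j < J.+1) up_weight s h j * (up_threshold h j < y)%R%:R
  <= expR (s * h) * expR (s * Num.min y (J%:R * h)).
Proof.
move=> s0 h0 y0.
pose S J := \sum_(j < J.+1) up_weight s h j * (up_threshold h j < y)%R%:R.
rewrite -/(S J).
suff : [/\ expR (s * Num.min y (J%:R * h)) <= S J,
    S J <= expR (s * h) * expR (s * Num.min y (J%:R * h)) &
    (J%:R * h <= y -> S J = expR (s * (J%:R * h)))] by case=> -> ->.
have sh : 1 <= expR (s * h) by rewrite -[1]expR0 ler_expR mulr_ge0.
elim: J => [|J [IH1 IH2 IH3]].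
  rewrite /S big_ord1/= mul0r mulr0.
  have -> : -1 < y by lra.
  have -> : Num.min y 0 = 0 by apply/min_idPr.
  by rewrite mulr0 expR0 !mulr1.
have SE : S J.+1 = S J + (expR (s * (J.+1%:R * h)) - expR (s * (J%:R * h)))
    * (J%:R * h < y)%R%:R by rewrite /S big_ord_recr.
have JS : J.+1%:R * h = J%:R * h + h by rewrite -natr1 mulrDl mul1r.
have [Jy|yJ] := ltP (J%:R * h) y; last first.
  rewrite SE ltNge yJ mulr0 addr0.
  have m1 : Num.min y (J%:R * h) = y by apply/min_idPl.
  have m2 : Num.min y (J.+1%:R * h) = y by apply/min_idPl; lra.
  rewrite m2; move: IH1 IH2; rewrite m1 => IH1 IH2; split => // yJ1.
  have h00 : h = 0 by lra.
  by rewrite IH3 ?h00 ?mulr0//; lra.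
have SJ1 : S J.+1 = expR (s * (J.+1%:R * h)).
  by rewrite SE Jy mulr1 IH3 ?(ltW Jy)// addrC subrK.
rewrite SJ1; split => //; first by rewrite ler_expR ler_wpM2l// ge_min lexx orbT.
rewrite -expRD ler_expR -mulrDr ler_wpM2l// JS.
by rewrite [leLHS]addrC lerD2l le_min (ltW Jy) lerDl.
Qed.

(** The decreasing counterpart, with indicators of [y <= x]. The constant term
    [expR (- s * (J * h))] becomes the indicator of [y <= b], so that the step
    function dominates the exponential only up to [b]. *)
Definition down_threshold h b J (j : nat) : R :=
  if (j < J)%N then j.+1%:R * h else b.

Definition down_weight s h J (j : nat) : R :=
  if (j < J)%N then expR (- s * (j%:R * h)) - expR (- s * (j.+1%:R * h))
  else expR (- s * (j%:R * h)).

Lemma down_weight_ge0 s h J j : 0 <= s -> 0 <= h -> 0 <= down_weight s h J j.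
Proof.
move=> s0 h0; rewrite /down_weight; case: ifP => _; last exact: expR_ge0.
by rewrite subr_ge0 ler_expR !mulNr lerN2 ler_wpM2l// ler_wpM2r// ler_nat.
Qed.

Lemma down_steps s h b y J : 0 <= s -> 0 <= h -> 0 <= y ->
  (y <= b -> expR (- s * Num.min y (J%:R * h)) <=
    \sum_(j < J.+1) down_weight s h J j * (y <= down_threshold h b J j)%R%:R) /\
  \sum_(j < J.+1) down_weight s h J j * (y <= down_threshold h b J j)%R%:R
    <= expR (s * h) * expR (- s * Num.min y (J%:R * h)).
Proof.
move=> s0 h0 y0.
pose A J := \sum_(j < J) (expR (- s * (j%:R * h)) - expR (- s * (j.+1%:R * h)))
   * (y <= j.+1%:R * h)%R%:R.
have SE : \sum_(j < J.+1) down_weight s h J j * (y <= down_threshold h b J j)%R%:R =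
    A J + expR (- s * (J%:R * h)) * (y <= b)%R%:R.
  rewrite big_ord_recr/= /down_weight /down_threshold ltnn; congr (_ + _).
  by apply: eq_bigr => j _; rewrite ltn_ord.
pose C J := A J + expR (- s * (J%:R * h)).
have sh : 1 <= expR (s * h) by rewrite -[1]expR0 ler_expR mulr_ge0.
suff : [/\ expR (- s * Num.min y (J%:R * h)) <= C J,
    C J <= expR (s * h) * expR (- s * Num.min y (J%:R * h)) &
    (J%:R * h < y -> C J = expR (- s * (J%:R * h)))].
  rewrite SE; case=> h1 h2 _; split=> [->|]; first by rewrite mulr1.
  apply: le_trans h2; rewrite lerD2l ler_piMr ?expR_ge0//; by rewrite lern1 leq_b1.
elim: J {SE} => [|J [IH1 IH2 IH3]].
  rewrite /C /A big_ord0/= !mul0r add0r mulr0.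
  have -> : Num.min y 0 = 0 by apply/min_idPr.
  by rewrite mulr0 expR0 !mulr1.
have CE : C J.+1 = C J - (expR (- s * (J%:R * h)) - expR (- s * (J.+1%:R * h)))
    * (J.+1%:R * h < y)%R%:R.
  rewrite /C /A big_ord_recr /= ltNge; case: (_ <= _) => /=; lra.
have JS : J.+1%:R * h = J%:R * h + h by rewrite -natr1 mulrDl mul1r.
have [Jy|yJ] := ltP (J.+1%:R * h) y.
  rewrite CE Jy IH3; last by lra.
  by rewrite mulr1 subKr; split => //; rewrite ler_peMl ?expR_ge0.
rewrite CE ltNge yJ mulr0 subr0; split; last by [].
  apply: le_trans IH1; rewrite ler_expR !mulNr lerN2 ler_wpM2l//.
  by rewrite ge_min lexx.
have [yJ'|Jy'] := leP y (J%:R * h).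
  by move: IH2; rewrite (min_idPl yJ').
rewrite IH3// -expRD ler_expR; nra.
Qed.

End ExponentialSteps.

(** * Chernoff bounds for nonnegative orthant dependent sequences *)

Section NonnegativeSequence.
Context d (T : measurableType d) (R : realType) (P : probability T R).
Context (X : nat -> {RV P >-> R}) (F : probability R R).
Hypothesis XF : common_distribution X F.
Hypothesis Fpos : nonneg_supported F.
Local Notation pr := (prob P).

Lemma measurable_RV i : measurable_fun setT (X i : T -> R).
Proof. exact: measurable_funPT. Qed.

Lemma prob_RV i (A : set R) : measurable A -> pr [set w | A (X i w)] = prob F A.
Proof. by move=> mA; rewrite /prob -(XF i mA). Qed.

Lemma measurable_RV_set i (A : set R) : measurable A -> measurable [set w | A (X i w)].
Proof. by move=> mA; rewrite -[X in measurable X]setTI; exact: measurable_RV. Qed.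

Lemma measurable_RV_gt i x : measurable [set w | x < X i w].
Proof.
have -> : [set w | x < X i w] = [set w | [set` `]x, +oo[] (X i w)].
  by apply/seteqP; split => w /=; rewrite in_itv/= andbT.
exact: measurable_RV_set.
Qed.

Lemma measurable_RV_le i x : measurable [set w | X i w <= x].
Proof.
have -> : [set w | X i w <= x] = [set w | [set` `]-oo, x]] (X i w)].
  by apply/seteqP; split => w /=; rewrite in_itv/=.
exact: measurable_RV_set.
Qed.

Lemma prob_RV_gt i x : pr [set w | x < X i w] = tail F x.
Proof.
rewrite tailE -(prob_RV i)//; congr (pr _).
by apply/seteqP; split => w /=; rewrite in_itv/= andbT.
Qed.

Lemma prob_RV_le i x : pr [set w | X i w <= x] = prob F [set` `]-oo, x]].
Proof.
by rewrite -(prob_RV i).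
Qed.

Definition nonneg_event : set T := [set w | forall i, 0 <= X i w].

Lemma measurable_nonneg_event : measurable nonneg_event.
Proof.
have -> : nonneg_event = \bigcap_i [set w | [set` `[0, +oo[] (X i w)].
  apply/seteqP; split => w h i; last by have := h i I; rewrite /= in_itv/= andbT.
  by rewrite /= in_itv/= h.
by apply: bigcap_measurable => // i _; exact: measurable_RV_set.
Qed.

Lemma prob_nonneg_eventC : pr (~` nonneg_event) = 0.
Proof.
have -> : ~` nonneg_event = \bigcup_i [set w | (~` [set` `[0, +oo[]) (X i w)].
  apply/seteqP; split => w /=.
    move=> /existsNP[i h]; exists i => //=; by rewrite in_itv/= andbT.
  move=> [i _ /=] h hn; apply: h; rewrite in_itv/= andbT; exact: hn.
have m0 i : measurable [set w | (~` [set` `[(0 : R), +oo[]) (X i w)].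
  by apply: measurable_RV_set; exact: measurableC.
apply: le_anti; rewrite prob_ge0 andbT.
have := @prob_bigcup_geometric _ _ _ P _ 0 0 0 m0 (lexx 0).
rewrite lexx ltr01 mul0r => /(_ isT); apply => i.
rewrite mul0r add0n prob_RV; last exact: measurableC.
by rewrite /prob nonneg_null.
Qed.

Lemma le_prob_nonneg A B : measurable A -> measurable B ->
  (forall w, (forall i, 0 <= X i w) -> A w -> B w) -> pr A <= pr B.
Proof.
move=> mA mB AB; have mN := measurable_nonneg_event.
apply: le_trans (prob_le_setD P mA mN) _.
have -> : pr (A `\` nonneg_event) = 0.
  apply: le_anti; rewrite prob_ge0 andbT -prob_nonneg_eventC.
  by apply: le_prob; [exact: measurableD|exact: measurableC|exact: subIsetr].
rewrite addr0; apply: le_prob => //; first exact: measurableI.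
by move=> w [Aw Nw]; exact: AB.
Qed.

Lemma measurable_sum_set n (f : R -> R) (A : set R) :
  measurable_fun setT f -> measurable A ->
  measurable [set w | A (\sum_(i < n) f (X i w))].
Proof.
move=> mf mA; rewrite -[X in measurable X]setTI.
have mS : measurable_fun setT (fun w => \sum_(i < n) f (X i w)).
  by apply: measurable_sum => i; apply: measurableT_comp => //; exact: measurable_RV.
exact: mS.
Qed.

Lemma measurable_trunc (K : R) : measurable_fun setT (fun x : R => Num.min x K).
Proof. exact: measurable_minr. Qed.

Section ExtendedNegativeDependence.
Context (M : R).
Hypothesis M0 : 0 < M.
Hypothesis XM : ENOD X M.

Lemma ENOD_gt n (x : nat -> R) : (0 < n)%N ->
  pr [set w | forall i : 'I_n, x i < X i w] <= M * \prod_(i < n) tail F (x i).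
Proof.
move=> n0; have [+ _] := XM x n0.
have -> : \bigcap_(i < n) [set w | x i < X i w] =
    [set w | forall i : 'I_n, x i < X i w].
  apply/seteqP; split => w h i; first exact: (h i (ltn_ord i)).
  by move=> ni; exact: (h (Ordinal ni)).
have mA : measurable [set w | forall i : 'I_n, x i < X i w].
  have -> : [set w | forall i : 'I_n, x i < X i w] =
      \bigcap_(i in [set: 'I_n]) [set w | x i < X i w].
    by apply/seteqP; split => [w h i _|w h i]; [exact: h|exact: (h i I)].
  by apply: fin_bigcap_measurable => // i _; exact: measurable_RV_gt.
under eq_bigr do rewrite (probE P (measurable_RV_gt _ _)) prob_RV_gt.
by rewrite prodEFin -EFinM (probE P mA) lee_fin.
Qed.

Lemma ENOD_le n (x : nat -> R) : (0 < n)%N ->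
  pr [set w | forall i : 'I_n, X i w <= x i] <=
  M * \prod_(i < n) prob F [set` `]-oo, x i]].
Proof.
move=> n0; have [_ +] := XM x n0.
have -> : \bigcap_(i < n) [set w | X i w <= x i] =
    [set w | forall i : 'I_n, X i w <= x i].
  apply/seteqP; split => w h i; first exact: (h i (ltn_ord i)).
  by move=> ni; exact: (h (Ordinal ni)).
have mA : measurable [set w | forall i : 'I_n, X i w <= x i].
  have -> : [set w | forall i : 'I_n, X i w <= x i] =
      \bigcap_(i in [set: 'I_n]) [set w | X i w <= x i].
    by apply/seteqP; split => [w h i _|w h i]; [exact: h|exact: (h i I)].
  by apply: fin_bigcap_measurable => // i _; exact: measurable_RV_le.
under eq_bigr do rewrite (probE P (measurable_RV_le _ _)) prob_RV_le.
by rewrite prodEFin -EFinM (probE P mA) lee_fin.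
Qed.

Lemma grid_step n s K : 0 < s -> 0 < K ->
  exists (J : nat) (h : R), [/\ 0 < h, J%:R * h = K & s * h * n%:R <= 1].
Proof.
move=> s0 K0; pose b := s * K * n%:R.
have b0 : 0 <= b by rewrite mulr_ge0// mulr_ge0// ltW.
pose J := (Num.bound b).+1.
have J0 : (0 : R) < J%:R by rewrite ltr0n.
exists J, (K / J%:R); split; first exact: divr_gt0.
  by rewrite mulrC divfK// gt_eqF.
have bJ : b <= J%:R.
  apply: le_trans (ltW (archi_boundP b0)) _.
  by rewrite ler_nat.
have -> : s * (K / J%:R) * n%:R = b / J%:R by rewrite /b; field; exact: lt0r_neq0.
by rewrite ler_pdivrMr// mul1r.
Qed.

(** Chernoff's inequality. The factor [expR 1] pays for replacing the
    exponential by a step function on a grid of mesh [h], where [s * h * n <= 1]. *)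
Lemma ENOD_chernoff_up n s K r (g : R -> R) : (0 < n)%N -> 0 < s -> 0 < K ->
  F.-integrable [set` `[0, +oo[] (EFin \o g) ->
  (forall y, 0 <= y -> expR (s * Num.min y K) <= g y) ->
  pr [set w | r < \sum_(i < n) Num.min (X i w) K] <=
  M * expR 1 * expR (- (s * r)) * (Rintegral F [set` `[0, +oo[] g) ^+ n.
Proof.
move=> n0 s0 K0 ig hg; have [J [h [h0 JhK shn]]] := grid_step n s0 K0.
pose A (i : nat) (j : 'I_J.+1) := [set w | up_threshold h j < X i w].
pose a (j : 'I_J.+1) := up_weight s h j.
pose p (j : 'I_J.+1) := tail F (up_threshold h j).
pose S := [set w | r < \sum_(i < n) Num.min (X i w) K].
have mS : measurable S.
  rewrite /S; have := @measurable_sum_set n (fun x => Num.min x K) [set` `]r, +oo[]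
    (measurable_trunc K) (measurable_itv _).
  by congr (measurable _); apply/seteqP; split => w /=; rewrite in_itv/= andbT.
have mN := measurable_nonneg_event.
pose B := S `&` nonneg_event.
have mB : measurable B by exact: measurableI.
have key : expR (s * r) * pr B <= M * (\sum_j a j * p j) ^+ n.
  apply: (@step_moment_markov _ _ _ P n J.+1 A a p) => //.
  - by move=> i j; exact: measurable_RV_gt.
  - by move=> j; apply: up_weight_ge0; exact: ltW.
  - move=> f; pose x i := if insub i is Some j then up_threshold h (f j) else 0.
    have xE (i : 'I_n) : x i = up_threshold h (f i) by rewrite /x valK.
    have := ENOD_gt x n0.
    have -> : \prod_(i < n) tail F (x i) = \prod_i p (f i).
      by apply: eq_bigr => i _; rewrite xE.
    congr (pr _ <= _); apply/seteqP; split => w H i; move: (H i); rewrite /A /= xE//.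
  - move=> w [Sw Nw].
    apply: le_trans (_ : \prod_(i < n) expR (s * Num.min (X i w) K) <= _).
      rewrite -expR_sum ler_expR -mulr_sumr ler_pM2l//; exact: ltW.
    apply: ler_prod => i _; rewrite expR_ge0/=.
    have /andP[+ _] := up_steps J (ltW s0) (ltW h0) (Nw i).
    rewrite JhK => /le_trans; apply; rewrite le_eqVlt; apply/orP; left; apply/eqP.
    apply: eq_bigr => j _; congr (_ * _).
    rewrite indicE; congr (nat_of_bool _)%:R.
    by apply/idP/idP; rewrite inE.
have sumE : \sum_j a j * p j <= expR (s * h) * Rintegral F [set` `[0, +oo[] g.
  rewrite -RintegralZl//.
  under eq_bigr do rewrite /p tailE.
  apply: (le_mean_step Fpos (A := fun j : 'I_J.+1 => [set` `]up_threshold h j, +oo[])) => //.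
    by have := integrableZl (measurable_itv _) (expR (s * h)) ig; apply: eq_integrable.
  move=> y y0; have /andP[_] := up_steps J (ltW s0) (ltW h0) y0.
  rewrite JhK => hy; apply: le_trans (_ : expR (s * h) * expR (s * Num.min y K) <= _).
    apply: le_trans hy; rewrite le_eqVlt; apply/orP; left; apply/eqP.
    apply: eq_bigr => j _; congr (_ * _); rewrite indicE; congr (nat_of_bool _)%:R.
    by apply/idP/idP; rewrite inE/= in_itv/= andbT.
  by rewrite ler_pM2l ?expR_gt0// hg.
have sum0 : 0 <= \sum_j a j * p j.
  by apply: sumr_ge0 => j _; rewrite mulr_ge0 ?tail_ge0//; apply: up_weight_ge0; exact: ltW.
have SB : pr S <= pr B by apply: le_prob_nonneg.
apply: le_trans SB _.
rewrite -(ler_pM2l (expR_gt0 (s * r))); apply: le_trans key _.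
set E := Rintegral _ _ _.
have -> : expR (s * r) * (M * expR 1 * expR (- (s * r)) * E ^+ n) =
    M * (expR 1 * E ^+ n).
  have e1 : expR (s * r) * expR (- (s * r)) = 1 by rewrite -expRD subrr expR0.
  by rewrite -[RHS]mul1r -[X in _ = X * _]e1; ring.
rewrite ler_pM2l//.
apply: le_trans (_ : (expR (s * h) * E) ^+ n <= _).
  by rewrite lerXn2r// nnegrE; apply: le_trans sumE.
rewrite exprMn -expRM_natr; apply: ler_wpM2r; last by rewrite ler_expR.
apply: exprn_ge0; have := le_trans sum0 sumE; by rewrite pmulr_rge0 ?expR_gt0.
Qed.

(** The step function below vanishes beyond [b], so that every factor is an
    indicator of a proper half-line; [b] is so large that exceeding it is
    negligible against the bound itself. *)
Lemma ENOD_chernoff_down mu n s K r (g : R -> R) : has_mean F mu ->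
  (0 < n)%N -> 0 < s -> 0 < K ->
  F.-integrable [set` `[0, +oo[] (EFin \o g) ->
  (forall y, 0 <= y -> expR (- s * Num.min y K) <= g y) ->
  pr [set w | \sum_(i < n) Num.min (X i w) K <= r] <=
  2 * (M * expR 1 * expR (s * r) * (Rintegral F [set` `[0, +oo[] g) ^+ n).
Proof.
move=> Fmu n0 s0 K0 ig hg; have [J [h [h0 JhK shn]]] := grid_step n s0 K0.
set E := Rintegral _ _ _.
set bd := M * _ * _ * _.
have E0 : 0 < E.
  apply: lt_le_trans (_ : expR (- s * K) <= _); first exact: expR_gt0.
  have <- : Rintegral F [set` `[0, +oo[] (cst (expR (- s * K))) = expR (- s * K).
    exact: E_cst.
  apply: le_Rintegral => //; first exact: finite_measure_integrable_cst.
  move=> y; rewrite /= in_itv/= andbT => y0; apply: le_trans (hg y y0).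
  by rewrite ler_expR !mulNr lerN2 ler_pM2l// ge_min lexx orbT.
have bd0 : 0 < bd by rewrite /bd !mulr_gt0// ?expR_gt0// exprn_gt0.
have nR : (0 : R) < n%:R by rewrite ltr0n.
have [b b0 hb] := tail_cvg0 Fpos Fmu (divr_gt0 bd0 nR).
pose A (i : nat) (j : 'I_J.+1) := [set w | X i w <= down_threshold h b J j].
pose a (j : 'I_J.+1) := down_weight s h J j.
pose p (j : 'I_J.+1) := prob F [set` `]-oo, down_threshold h b J j]].
pose S := [set w | \sum_(i < n) Num.min (X i w) K <= r].
have mS : measurable S.
  rewrite /S; have := @measurable_sum_set n (fun x => Num.min x K) [set` `]-oo, r]]
    (measurable_trunc K) (measurable_itv _).
  by congr (measurable _); apply/seteqP; split => w /=; rewrite in_itv/=.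
have mN := measurable_nonneg_event.
pose L := \bigcup_(i < n) [set w | b < X i w].
have mL : measurable L by apply: bigcup_measurable => i _; exact: measurable_RV_gt.
pose B := (S `&` nonneg_event) `\` L.
have mB : measurable B by apply: measurableD => //; exact: measurableI.
have key : expR (- s * r) * pr B <= M * (\sum_j a j * p j) ^+ n.
  apply: (@step_moment_markov _ _ _ P n J.+1 A a p) => //.
  - by move=> i j; exact: measurable_RV_le.
  - by move=> j; apply: down_weight_ge0; exact: ltW.
  - move=> f; pose x i := if insub i is Some j then down_threshold h b J (f j) else 0.
    have xE (i : 'I_n) : x i = down_threshold h b J (f i) by rewrite /x valK.
    have := ENOD_le x n0.
    have -> : \prod_(i < n) prob F [set` `]-oo, x i]] = \prod_i p (f i).
      by apply: eq_bigr => i _; rewrite xE.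
    congr (pr _ <= _); apply/seteqP; split => w H i; move: (H i); rewrite /A /= xE//.
  - move=> w [[Sw Nw] Lw].
    apply: le_trans (_ : \prod_(i < n) expR (- s * Num.min (X i w) K) <= _).
      by rewrite -expR_sum ler_expR -mulr_sumr !mulNr lerN2 ler_pM2l.
    apply: ler_prod => i _; rewrite expR_ge0/=.
    have [+ _] := @down_steps _ s h b (X i w) J (ltW s0) (ltW h0) (Nw i).
    have Xb : X i w <= b.
      by rewrite leNgt; apply/negP => bX; apply: Lw; exists i => //; exact: ltn_ord.
    rewrite JhK => /(_ Xb)/le_trans; apply; rewrite le_eqVlt; apply/orP; left; apply/eqP.
    apply: eq_bigr => j _; congr (_ * _).
    rewrite indicE; congr (nat_of_bool _)%:R.
    by apply/idP/idP; rewrite inE.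
have sumE : \sum_j a j * p j <= expR (s * h) * E.
  rewrite -RintegralZl//.
  apply: (le_mean_step Fpos (A := fun j : 'I_J.+1 => [set` `]-oo, down_threshold h b J j]])) => //.
    by have := integrableZl (measurable_itv _) (expR (s * h)) ig; apply: eq_integrable.
  move=> y y0; have [_] := @down_steps _ s h b y J (ltW s0) (ltW h0) y0.
  rewrite JhK => hy; apply: le_trans (_ : expR (s * h) * expR (- s * Num.min y K) <= _).
    apply: le_trans hy; rewrite le_eqVlt; apply/orP; left; apply/eqP.
    apply: eq_bigr => j _; congr (_ * _); rewrite indicE; congr (nat_of_bool _)%:R.
    by apply/idP/idP; rewrite inE/= in_itv/=.
  by rewrite ler_pM2l ?expR_gt0// hg.
have sum0 : 0 <= \sum_j a j * p j.
  by apply: sumr_ge0 => j _; rewrite mulr_ge0 ?prob_ge0//; apply: down_weight_ge0; exact: ltW.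
have SB : pr S <= pr (B `|` L).
  apply: le_prob_nonneg => //; first exact: measurableU.
  move=> w Nw Sw; have [Lw|Lw] := pselect (L w); [by right|by left].
apply: le_trans SB _; apply: le_trans (probU_le _ mB mL) _.
rewrite mulr2n mulrDl mul1r; apply: lerD; last first.
  apply: le_trans (prob_bigcup_ord_le P n (fun i => measurable_RV_gt i b)) _.
  under eq_bigr do rewrite prob_RV_gt.
  by rewrite sumr_const card_ord -mulr_natr -ler_pdivlMr.
rewrite -(ler_pM2l (expR_gt0 (- s * r))); apply: le_trans key _.
have -> : expR (- s * r) * bd = M * (expR 1 * E ^+ n).
  have e1 : expR (s * r) * expR (- s * r) = 1 by rewrite mulNr -expRD subrr expR0.
  by rewrite -[RHS]mul1r -[X in _ = X * _]e1 /bd; ring.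
rewrite ler_pM2l//.
apply: le_trans (_ : (expR (s * h) * E) ^+ n <= _).
  by rewrite lerXn2r// nnegrE; apply: le_trans sumE.
rewrite exprMn -expRM_natr; apply: ler_wpM2r; last by rewrite ler_expR.
by rewrite exprn_ge0// ltW.
Qed.

End ExtendedNegativeDependence.

End NonnegativeSequence.

(** Nonnegativity, respectively positivity, of products of quantities that are
    so by hypothesis or by nature. *)
Ltac nneg := by repeat first [assumption | exact: ler01 | exact: ler0n
  | exact: expR_ge0 | exact: tail_ge0 | exact: prob_ge0 | (apply: ltW; assumption)
  | apply: divr_ge0 | apply: mulr_ge0 | apply: exprn_ge0 | rewrite invr_ge0
  | apply: addr_ge0].

Ltac pos := by repeat first [assumption | exact: ltr01 | exact: ltr0Sn
  | exact: expR_gt0 | apply: divr_gt0 | apply: mulr_gt0 | apply: exprn_gt0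
  | rewrite invr_gt0].

(** * Precise large deviations of partial sums *)

Section ExponentialComparison.
Context (R : realType).

Lemma expR_le1Dx (z : R) : expR z <= 1 + z * expR z.
Proof.
have := expR_ge1Dx (- z); rewrite -(ler_pM2r (expR_gt0 z)) -expRD addNr expR0.
lra.
Qed.

Lemma expRN_le (z : R) : 0 <= z -> expR (- z) <= 1 - z + z ^+ 2.
Proof.
move=> z0; rewrite expRN -[leLHS]mul1r ler_pdivrMr ?expR_gt0//.
have h : 0 <= 1 - z + z ^+ 2 by nra.
apply: le_trans (ler_wpM2l h (expR_ge1Dx z)).
have := exprn_ge0 3 z0; rewrite !exprS expr0; lra.
Qed.

Lemma expr_le_expR (k : nat) (c : R) : 0 < c ->
  exists C : R, 0 < C /\ forall a, 0 <= a -> a ^+ k <= C * expR (c * a).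
Proof.
move=> c0; pose k' : R := k.+1%:R; have k'0 : 0 < k' by rewrite ltr0n.
exists ((k' / c) ^+ k); split; first by rewrite exprn_gt0// divr_gt0.
move=> a a0.
have h : a <= (k' / c) * expR (c * a / k').
  have := expR_ge1Dx (c * a / k') => h.
  have h' : c * a / k' <= expR (c * a / k') by apply: le_trans h; rewrite lerDr.
  have aE : a = k' / c * (c * a / k') by field; rewrite !gt_eqF.
  by rewrite {1}aE ler_pM2l ?divr_gt0.
apply: le_trans (_ : (k' / c * expR (c * a / k')) ^+ k <= _).
  by rewrite lerXn2r// nnegrE; nneg.
rewrite exprMn -expRM_natr ler_pM2l; last by rewrite exprn_gt0// divr_gt0.
rewrite ler_expR -mulrA -[leRHS]mulr1 ler_wpM2l//; first by rewrite mulr_ge0// ltW.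
by rewrite mulrC ler_pdivrMr// mul1r /k' ler_nat.
Qed.

(** Polynomial decay of a consistently varying tail loses against any exponential. *)
Lemma expRN_tail (G : probability R R) (k e : R) : consistently_varying G ->
  0 < k -> 0 < e ->
  exists x0 : R, 0 < x0 /\ forall x, x0 <= x -> expR (- (k * x)) <= e * tail G x.
Proof.
move=> CG k0 e0; have [p hp] := tail_potter CG.
have G1 := consistently_varying_gt0 CG 1.
have [C [C0 hC]] := expr_le_expR p.+1 k0.
pose D := C * 2 ^+ p / (tail G 1 * e).
have D0 : 0 < D by rewrite divr_gt0// mulr_gt0// exprn_gt0.
exists (Num.max 1 D); split; first by rewrite lt_max ltr01.
move=> x; rewrite ge_max => /andP[x1 xD].
have x0 : 0 < x by lra.
have xC := hC x (ltW x0).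
have := hp x 1 x1 ler01; rewrite mulr1 => hx.
have xp0 : 0 < x ^+ p by rewrite exprn_gt0.
rewrite expRN -[leLHS]mul1r ler_pdivrMr ?expR_gt0//.
apply: le_trans (_ : e * tail G x * (x ^+ p.+1 / C) <= _); last first.
  apply: ler_wpM2l; first by rewrite mulr_ge0 ?tail_ge0// ltW.
  by rewrite ler_pdivrMr// mulrC.
have : 1 <= x / D by rewrite ler_pdivlMr// mul1r.
move=> /le_trans; apply.
rewrite exprS.
have -> : x / D = x * (e / C) * (tail G 1 / 2 ^+ p).
  by rewrite /D; field; rewrite !gt_eqF// exprn_gt0.
have -> : e * tail G x * (x * x ^+ p / C) = x * (e / C) * (tail G x * x ^+ p).
  by field; rewrite gt_eqF.
apply: ler_wpM2l; first by rewrite mulr_ge0 ?divr_ge0// ltW.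
rewrite ler_pdivrMr ?exprn_gt0//; apply: le_trans hx _.
by rewrite exprMn mulrC; lra.
Qed.

End ExponentialComparison.

Section LargeDeviations.
Context d (T : measurableType d) (R : realType) (P : probability T R).
Local Notation pr := (prob P).

Section UpperBounds.
Context (X : nat -> {RV P >-> R}) (F G : probability R R) (mu muG M C0 : R).
Hypothesis XF : common_distribution X F.
Hypothesis Fpos : nonneg_supported F.
Hypothesis Fmu : has_mean F mu.
Hypothesis mu0 : 0 < mu.
Hypothesis M0 : 0 < M.
Hypothesis XM : ENOD X M.
Hypothesis CG : consistently_varying G.
Hypothesis Gpos : nonneg_supported G.
Hypothesis Gmu : has_mean G muG.
Hypothesis C00 : 0 < C0.
Hypothesis FG : forall x, 0 <= x -> tail F x <= C0 * tail G x.

Lemma measurable_partial_sum n : measurable_fun setT (fun w => \sum_(i < n) X i w).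
Proof. by apply: measurable_sum => i; exact: measurable_RV. Qed.

Lemma measurable_sum_trunc n K :
  measurable_fun setT (fun w => \sum_(i < n) Num.min (X i w) K).
Proof.
apply: measurable_sum => i; apply: (measurableT_comp (measurable_trunc K)).
exact: measurable_RV.
Qed.

Lemma measurable_gt (f : T -> R) r : measurable_fun setT f ->
  measurable [set w | r < f w].
Proof.
move=> mf; rewrite -[X in measurable X]setTI.
have -> : [set w | r < f w] = f @^-1` [set` `]r, +oo[].
  by apply/seteqP; split => w /=; rewrite in_itv/= andbT.
exact: mf.
Qed.

Lemma measurable_le (f : T -> R) r : measurable_fun setT f ->
  measurable [set w | f w <= r].
Proof.
move=> mf; rewrite -[X in measurable X]setTI.
have -> : [set w | f w <= r] = f @^-1` [set` `]-oo, r]].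
  by apply/seteqP; split => w /=; rewrite in_itv/=.
exact: mf.
Qed.

Lemma measurable_lt (f : T -> R) r : measurable_fun setT f ->
  measurable [set w | f w < r].
Proof.
move=> mf; rewrite -[X in measurable X]setTI.
have -> : [set w | f w < r] = f @^-1` [set` `]-oo, r[].
  by apply/seteqP; split => w /=; rewrite in_itv/=.
exact: mf.
Qed.

(** The exponential tilt must adapt to the tail because only a first moment is
    at hand: with [q = n * tail G K] and [a = - ln q], tilting by
    [(1 - theta ^+ 2) * a / K] makes the part of the moment below [K / a ^+ 2]
    cancel the centring and the part above it bounded, by the Potter bound. What
    remains is [q] to the power [(1 - theta ^+ 2) / (1 - theta) = 1 + theta],
    which is negligible against [q] itself. *)
Lemma truncated_sum_negligible theta gam e : 0 < theta < 1 -> 0 < gam -> 0 < e ->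
  exists x0 : R, 0 < x0 /\ forall x n, x0 <= x -> gam * n%:R <= x ->
    pr [set w | n%:R * mu + x < \sum_(i < n) Num.min (X i w) ((1 - theta) * x)] <=
    e * (n%:R * tail G ((1 - theta) * x)).
Proof.
move=> /andP[th0 th1] gam0 e0.
have [p hp] := tail_potter CG.
have th20 : 0 < theta ^+ 2 by rewrite exprn_gt0.
have [c2 [c20 hc2]] := expr_le_expR (2 * p) th20.
pose c1 := mu * expR 1 / (gam * (1 - theta)).
have omth : 0 < 1 - theta by lra.
have c10 : 0 < c1 by rewrite divr_gt0// mulr_gt0// expR_gt0.
pose c3 := C0 * 2 ^+ p * c2.
pose b := M * expR 1 * expR (c1 + c3).
have b0 : 0 < b by rewrite !mulr_gt0// expR_gt0.
pose a0 := Num.max 1 (ln (b / e) / theta).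
have [y0 [y00 hy0]] := mul_tail_cvg0 Gpos Gmu
  (mulr_gt0 (expR_gt0 (- a0)) (mulr_gt0 gam0 omth)).
exists (y0 / (1 - theta)); split; first exact: divr_gt0.
move=> x n; rewrite ler_pdivrMr// => yx nx.
set K := (1 - theta) * x.
have Kx : K = x * (1 - theta) by rewrite mulrC.
have K0 : 0 < K by rewrite Kx; lra.
have x0 : 0 < x by move: K0; rewrite Kx pmulr_lgt0.
case: n nx => [|n] nx.
  rewrite !mul0r mulr0 add0r.
  have -> : [set w | x < \sum_(i < 0) Num.min (X i w) K] = set0.
    by apply/seteqP; split => w //=; rewrite big_ord0 => ?; lra.
  by rewrite /prob measure0.
set N := n.+1%:R in nx *.
have N0 : 0 < N :> R by rewrite ltr0n.
set q := N * tail G K.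
have GK := consistently_varying_gt0 CG K.
have q0 : 0 < q by rewrite mulr_gt0.
have q_le : q <= expR (- a0).
  have := hy0 K; rewrite {1}Kx => /(_ yx) hK.
  rewrite -(ler_pM2r (mulr_gt0 gam0 omth)); apply: le_trans hK.
  have -> : q * (gam * (1 - theta)) = (gam * N) * ((1 - theta) * tail G K).
    by rewrite /q; ring.
  have -> : K * tail G K = x * ((1 - theta) * tail G K) by rewrite {1}Kx mulrA.
  by apply: ler_wpM2r; rewrite ?mulr_ge0 ?tail_ge0// ltW.
pose a := - ln q.
have qE : q = expR (- a) by rewrite /a opprK lnK.
have aa0 : a0 <= a by move: q_le; rewrite qE ler_expR lerN2.
have a1 : 1 <= a by apply: le_trans aa0; rewrite le_max lexx.
have a0' : 0 < a by lra.
have omth2 : 0 < 1 - theta ^+ 2 by nra.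
pose s := (1 - theta ^+ 2) * a / K.
have s0 : 0 < s by rewrite divr_gt0// mulr_gt0.
pose A := K / a ^+ 2.
have a20 : 0 < a ^+ 2 by rewrite exprn_gt0.
have A0 : 0 < A by rewrite divr_gt0.
pose g (y : R) := 1 + s * expR (s * A) * y + expR (s * K) * \1_([set` `]A, +oo[]) y.
have mA : measurable [set` `]A, +oo[ : interval R] by [].
have i1 := intg_affine 1 (s * expR (s * A)) (intg_id Fmu).
have i2 := intgZ (expR (s * K)) (intg_indic F mA).
have ig : F.-integrable [set` `[0, +oo[] (EFin \o g) by exact: (intgD i1 i2).
have Eg : Rintegral F [set` `[0, +oo[] g =
    1 + s * expR (s * A) * mu + expR (s * K) * tail F A.
  rewrite /g RintegralD// (E_affine Fpos)//; last exact: (intg_id Fmu).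
  rewrite RintegralZl//; last exact: intg_indic.
  by rewrite (E_id Fpos Fmu) (E_indic Fpos)// tailE.
have hg y : 0 <= y -> expR (s * Num.min y K) <= g y.
  move=> y0'; rewrite /g; have [yA|yA] := leP y A.
    rewrite indicE memNset/= ?in_itv/= ?andbT; last by apply/negP; rewrite -leNgt.
    rewrite mulr0 addr0.
    apply: le_trans (_ : expR (s * y) <= _).
      by rewrite ler_expR ler_pM2l// ge_min lexx.
    apply: le_trans (expR_le1Dx _) _; rewrite lerD2l [leRHS]mulrAC.
    by apply: ler_wpM2l; [nneg|rewrite ler_expR ler_pM2l].
  rewrite indicE mem_set/= ?in_itv/= ?andbT// mulr1.
  apply: le_trans (_ : expR (s * K) <= _).
    by rewrite ler_expR ler_pM2l// ge_min lexx orbT.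
  by rewrite lerDr; nneg.
have := ENOD_chernoff_up XF Fpos M0 XM (N * mu + x) (ltn0Sn n) s0 K0 ig hg.
move=> /le_trans; apply; rewrite Eg.
set u := s * expR (s * A) * mu + expR (s * K) * tail F A.
have u0 : 0 <= u.
  by rewrite /u; nneg.
have -> : (1 + s * expR (s * A) * mu + expR (s * K) * tail F A) = 1 + u.
  by rewrite /u addrA.
have h1 : (1 + u) ^+ n.+1 <= expR (N * u).
  rewrite expRM_natl lerXn2r// ?nnegrE ?expR_ge0//; last exact: expR_ge1Dx.
  by rewrite addr_ge0.
apply: le_trans (ler_wpM2l _ h1) _.
  by nneg.
rewrite -[leLHS]mulrA -[X in _ * X <= _]expRD.
(* the part below [A]: the tilt is so small there that the mean almost cancels *)
have sA : s * A = (1 - theta ^+ 2) / a.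
  by rewrite /s /A; field; rewrite !gt_eqF.
have sA1 : s * A <= a^-1.
  rewrite sA -[leRHS]mul1r; apply: ler_wpM2r; first by nneg.
  by rewrite gerBl ltW.
have sA2 : s * A <= 1 by apply: le_trans sA1 _; rewrite invf_le1.
have Nsm : N * s * mu <= mu * a / (gam * (1 - theta)).
  have -> : N * s * mu = N * ((1 - theta ^+ 2) * (mu * a / ((1 - theta) * x))).
    by rewrite /s /K; field; rewrite !gt_eqF.
  have -> : mu * a / (gam * (1 - theta)) = (x / gam) * (mu * a / ((1 - theta) * x)).
    by field; rewrite !gt_eqF.
  have v0 : 0 <= mu * a / ((1 - theta) * x).
    by nneg.
  apply: ler_pM => //.
  - by nneg.
  - by rewrite ler_pdivlMr// mulrC.
  - by rewrite ler_piMl// gerBl ltW.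
have e1 : N * (s * expR (s * A) * mu) - s * (N * mu) <= c1.
  have -> : N * (s * expR (s * A) * mu) - s * (N * mu) =
    N * s * mu * (expR (s * A) - 1) by ring.
  apply: le_trans (_ : mu * a / (gam * (1 - theta)) * (expR 1 / a) <= _).
    apply: ler_pM => //.
    - by nneg.
    - by rewrite subr_ge0 -expR0 ler_expR; nneg.
    - apply: le_trans (_ : s * A * expR (s * A) <= _).
        by rewrite lerBlDl; exact: expR_le1Dx.
      by rewrite [leRHS]mulrC; apply: ler_pM => //; rewrite ?ler_expR//; nneg.
  rewrite /c1 le_eqVlt; apply/orP; left; apply/eqP.
  by field; rewrite !gt_eqF.
(* the part above [A]: by the Potter bound the tail at [A] exceeds that at [K]
   by a power of [a] only, which the unused [expR (- theta ^+ 2 * a)] of the tilt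
   absorbs *)
have e2 : N * (expR (s * K) * tail F A) <= c3.
  have sK : s * K = a - theta ^+ 2 * a by rewrite /s; field; rewrite gt_eqF.
  have FA : tail F A <= C0 * ((2 * a ^+ 2) ^+ p * tail G K).
    apply: le_trans (FG (ltW A0)) _; rewrite ler_pM2l//.
    have := hp (a ^+ 2) A; rewrite exprn_ege1// => /(_ isT (ltW A0)).
    by rewrite [a ^+ 2 * A]mulrC /A divfK// gt_eqF.
  apply: le_trans (_ : N * (expR (s * K) * (C0 * ((2 * a ^+ 2) ^+ p * tail G K))) <= _).
    by rewrite ler_pM2l// ler_pM2l// expR_gt0.
  have -> : N * (expR (s * K) * (C0 * ((2 * a ^+ 2) ^+ p * tail G K))) =
     expR (- a) * expR (s * K) * (C0 * (2 * a ^+ 2) ^+ p).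
    by rewrite -qE /q; ring.
  rewrite -expRD sK; have -> : - a + (a - theta ^+ 2 * a) = - (theta ^+ 2 * a) by ring.
  rewrite expRN mulrC ler_pdivrMr ?expR_gt0// /c3 exprMn -exprM -!mulrA.
  rewrite !ler_pM2l ?exprn_gt0//. rewrite [theta * _]mulrA; exact: hc2 (ltW a0').
have sx : s * x = (1 + theta) * a.
  by rewrite /s /K; field; rewrite !gt_eqF.
apply: le_trans (_ : M * expR 1 * expR (c1 + c3 - (1 + theta) * a) <= _).
  rewrite ler_pM2l ?mulr_gt0 ?expR_gt0// ler_expR /u.
  move: e1 e2; rewrite -sx; lra.
have -> : c1 + c3 - (1 + theta) * a = c1 + c3 + - (theta * a) + - a by ring.
rewrite expRD expRD -qE mulrA ler_pM2r// mulrA -/b.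
rewrite expRN ler_pdivrMr ?expR_gt0// mulrC -ler_pdivrMr//.
rewrite -[leLHS]lnK ?posrE ?divr_gt0// ler_expR.
have : ln (b / e) / theta <= a by apply: le_trans aa0; rewrite le_max lexx orbT.
by rewrite ler_pdivrMr// [a * _]mulrC.
Qed.

(** One big summand: a sum that exceeds its mean by [x] has a summand above
    [(1 - theta) * x], up to the truncated sum just dealt with. *)
Lemma large_deviation_upper theta gam e : 0 < theta < 1 -> 0 < gam -> 0 < e ->
  exists x0 : R, 0 < x0 /\ forall x n, x0 <= x -> gam * n%:R <= x ->
    pr [set w | n%:R * mu + x < \sum_(i < n) X i w] <=
    n%:R * tail F ((1 - theta) * x) + e * (n%:R * tail G ((1 - theta) * x)).
Proof.
move=> th gam0 e0; have [x0 [x00 h]] := truncated_sum_negligible th gam0 e0.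
exists x0; split => // x n xx nx.
set K := (1 - theta) * x.
pose U := \bigcup_(i < n) [set w | K < X i w].
pose V := [set w | n%:R * mu + x < \sum_(i < n) Num.min (X i w) K].
have mU : measurable U by apply: bigcup_measurable => i _; exact: measurable_RV_gt.
have mV : measurable V by apply: measurable_gt; exact: measurable_sum_trunc.
apply: le_trans (_ : pr (U `|` V) <= _).
  apply: le_prob; [apply: measurable_gt; exact: measurable_partial_sum|exact: measurableU|].
  move=> w /= hw; have [Uw|nU] := pselect (U w); [by left|right].
  rewrite /V/=; have -> // : \sum_(i < n) Num.min (X i w) K = \sum_(i < n) X i w.
  apply: eq_bigr => i _; apply/min_idPl; rewrite leNgt; apply/negP => hi.
  by apply: nU; exists i => //; exact: ltn_ord.
apply: le_trans (probU_le _ mU mV) _; apply: lerD; last exact: h.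
apply: le_trans (prob_bigcup_ord_le P n (fun i => measurable_RV_gt X i K)) _.
under eq_bigr do rewrite (prob_RV_gt XF).
by rewrite sumr_const card_ord mulr_natl.
Qed.

(** The sum exceeds [x] only if some summand exceeds [x / n], and a Potter bound
    compares the tails at [x / n] and at [x]. The polynomial loss in [n] will be
    met by exponentially small factors. *)
Lemma partial_sum_crude : exists p : nat, forall x n, 0 <= x ->
  pr [set w | x < \sum_(i < n) X i w] <= C0 * (n%:R * (2 * n%:R) ^+ p * tail G x).
Proof.
have [p hp] := tail_potter CG; exists p => x n x0.
case: n => [|n].
  rewrite !mul0r mulr0.
  have -> : [set w | x < \sum_(i < 0) X i w] = set0.
    by apply/seteqP; split => w //=; rewrite big_ord0 => ?; lra.
  by rewrite /prob measure0.
set N := n.+1%:R.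
have N0 : 0 < N :> R by rewrite ltr0n.
pose U := \bigcup_(i < n.+1) [set w | x / N < X i w].
have mU : measurable U by apply: bigcup_measurable => i _; exact: measurable_RV_gt.
apply: le_trans (_ : pr U <= _).
  apply: le_prob => //; first by apply: measurable_gt; exact: measurable_partial_sum.
  move=> w /= hw; apply: contrapT => nU; move: hw; apply/negP; rewrite -leNgt.
  apply: le_trans (_ : \sum_(i < n.+1) x / N <= _).
    apply: ler_sum => i _; rewrite leNgt; apply/negP => hi.
    by apply: nU; exists i => //; exact: ltn_ord.
  by rewrite sumr_const card_ord -mulr_natr divfK// gt_eqF.
apply: le_trans (prob_bigcup_ord_le P n.+1 (fun i => measurable_RV_gt X i (x / N))) _.
under eq_bigr do rewrite (prob_RV_gt XF).
rewrite sumr_const card_ord -[leLHS]mulr_natl -mulrA mulrCA ler_pM2l//.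
have xN0 : 0 <= x / N by rewrite divr_ge0// ltW.
apply: le_trans (FG xN0) _; rewrite ler_pM2l//.
have := hp N (x / N); rewrite ler1n => /(_ isT xN0).
by rewrite [N * _]mulrC divfK// gt_eqF.
Qed.

End UpperBounds.

Section LowerBounds.
Context (X : nat -> {RV P >-> R}) (F : probability R R) (mu M : R).
Hypothesis XF : common_distribution X F.
Hypothesis Fpos : nonneg_supported F.
Hypothesis Fmu : has_mean F mu.
Hypothesis mu0 : 0 < mu.
Hypothesis M0 : 0 < M.
Hypothesis XM : ENOD X M.

(** Nonnegative summands have exponential moments at negative arguments, so
    Chernoff's inequality gives an exponentially small lower tail from a mean
    alone; truncation at [K] keeps the second-order term finite. *)
Lemma truncated_sum_lower eta : 0 < eta ->
  exists K C k : R, [/\ 0 < K, 0 < C, 0 < k & forall n,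
    pr [set w | \sum_(i < n) Num.min (X i w) K <= n%:R * (mu - eta)] <=
    C * expR (- k) ^+ n].
Proof.
move=> eta0; have [K0 [K00 hK]] := truncated_mean_cvg Fpos Fmu (divr_gt0 eta0 (ltr0Sn R 1)).
set K := K0; pose m := truncated_mean F K.
have hm : mu - eta / 2 < m by exact: hK.
have K0' : 0 <= K by exact: ltW.
pose k := eta ^+ 2 / (16 * K ^+ 2).
have k0 : 0 < k by rewrite divr_gt0 ?mulr_gt0 ?exprn_gt0.
exists K, (Num.max 1 (2 * (M * expR 1))), k; split => //.
  by rewrite lt_max ltr01.
case=> [|n]; first by rewrite expr0 mulr1 le_max prob_le1//;
  apply: measurable_le; exact: measurable_sum_trunc.
pose s := eta / (4 * K ^+ 2).
have s0 : 0 < s by rewrite divr_gt0 ?mulr_gt0 ?exprn_gt0.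
pose g (y : R) := 1 + (s ^+ 2 * K - s) * Num.min y K.
have im := intg_min Fmu K0'.
have ig : F.-integrable [set` `[0, +oo[] (EFin \o g) by exact: (intg_affine _ _ im).
have Eg : Rintegral F [set` `[0, +oo[] g = 1 + (s ^+ 2 * K - s) * m.
  by rewrite /g (E_affine Fpos).
have hg y : 0 <= y -> expR (- s * Num.min y K) <= g y.
  move=> y0; rewrite /g; set z := Num.min y K.
  have z0 : 0 <= z by rewrite le_min y0.
  have zK : z <= K by rewrite ge_min lexx orbT.
  rewrite mulNr; apply: le_trans (expRN_le _) _; first by rewrite mulr_ge0// ltW.
  have : s ^+ 2 * z * z <= s ^+ 2 * z * K.
    by apply: ler_wpM2l => //; rewrite mulr_ge0// exprn_ge0// ltW.
  nra.
have := ENOD_chernoff_down XF Fpos M0 XM (n.+1%:R * (mu - eta)) Fmu (ltn0Sn n) s0 K00 ig hg.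
move=> /le_trans; apply; rewrite Eg.
have mK : m <= K.
  have <- : Rintegral F [set` `[0, +oo[] (cst K) = K by exact: E_cst.
  apply: le_Rintegral => //; first exact: (intg_cst F K).
  by move=> y _; rewrite ge_min lexx orbT.
have m0 : 0 <= m.
  by apply: Rintegral_ge0 => y; rewrite /= in_itv/= andbT => y0; rewrite le_min y0.
have g0 : 0 <= 1 + (s ^+ 2 * K - s) * m.
  rewrite -Eg; apply: Rintegral_ge0 => y; rewrite /= in_itv/= andbT => /hg.
  by apply: le_trans; exact: expR_ge0.
have key : s * (mu - eta) + (s ^+ 2 * K - s) * m <= - k.
  have h1 : s * (mu - eta) - s * m <= - (s * (eta / 2)).
    rewrite -mulrBr -mulrN ler_pM2l//; lra.
  have h2 : s ^+ 2 * K * m <= s ^+ 2 * K * K by rewrite ler_wpM2l// mulr_ge0// exprn_ge0// ltW.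
  have -> : - k = - (s * (eta / 2)) + s ^+ 2 * K * K.
    by rewrite /k /s; field; rewrite gt_eqF.
  lra.
apply: le_trans (_ : 2 * (M * expR 1) * expR (- k) ^+ n.+1 <= _); last first.
  by rewrite ler_wpM2r ?exprn_ge0 ?expR_ge0// le_max lexx orbT.
rewrite -[M * expR 1 * _ * _]mulrA mulrA ler_pM2l; last by pos.
rewrite [s * _]mulrCA expRM_natl -exprMn lerXn2r// ?nnegrE ?expR_ge0//; first by nneg.
apply: le_trans (ler_wpM2l (expR_ge0 _) (expR_ge1Dx _)) _.
by rewrite -expRD ler_expR.
Qed.

Lemma partial_sum_lower eta : 0 < eta ->
  exists C k : R, [/\ 0 < C, 0 < k & forall n,
    pr [set w | \sum_(i < n) X i w <= n%:R * (mu - eta)] <= C * expR (- k) ^+ n].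
Proof.
move=> eta0; have [K [C [k [K0 C0 k0 h]]]] := truncated_sum_lower eta0.
exists C, k; split => // n; apply: le_trans (h n).
apply: le_prob.
- by apply: measurable_le; exact: measurable_partial_sum.
- by apply: measurable_le; exact: measurable_sum_trunc.
by move=> w /=; apply: le_trans; apply: ler_sum => i _; rewrite ge_min lexx.
Qed.

(** Orthant dependence speaks of initial segments; the level [-1], exceeded almost
    surely, fills in the other indices. *)
Lemma ENOD_pair i j x : (i < j)%N -> 0 <= x ->
  pr ([set w | x < X i w] `&` [set w | x < X j w]) <= M * tail F x ^+ 2.
Proof.
move=> ij x0; pose y k := if (k == i) || (k == j) then x else -1.
have mA k : measurable [set w | y k < X k w] by exact: measurable_RV_gt.
have := ENOD_gt XF XM y (ltn0Sn j).
have t1 : tail F (-1) = 1.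
  apply: le_anti; rewrite tail_le1/=.
  have F1 : prob F [set` `[0, +oo[] = 1 by rewrite /prob (Fpos : F _ = 1%E).
  rewrite -F1 tailE; apply: le_prob => //.
  by move=> z /=; rewrite !in_itv/= !andbT; lra.
have -> : \prod_(k < j.+1) tail F (y k) = tail F x ^+ 2.
  rewrite big_ord_recr/= {2}/y eqxx orbT expr2; congr (_ * _).
  rewrite (bigD1 (Ordinal ij))//= {1}/y eqxx/= big1 ?mulr1// => k.
  rewrite -val_eqE/= => ki; rewrite /y (negbTE ki) ltn_eqF//=.
move=> h; apply: le_trans h; apply: (le_prob_nonneg XF Fpos).
- by apply: measurableI; exact: measurable_RV_gt.
- have -> : [set w | forall k : 'I_j.+1, y k < X k w] =
      \bigcap_(k in [set: 'I_j.+1]) [set w | y k < X k w].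
    by apply/seteqP; split => [w h k _|w h k]; [exact: h|exact: (h k I)].
  by apply: fin_bigcap_measurable => // k _; exact: mA.
move=> w Nw [/= wi wj] k; rewrite /y.
have [->//|_] := eqVneq (k : nat) i; have [->//|_] := eqVneq (k : nat) j.
by apply: lt_le_trans (Nw k).
Qed.

(** Bonferroni's inequality, with the pairs controlled by orthant dependence. *)
Lemma prob_max_lower n x : 0 <= x ->
  n%:R * tail F x - M * (n%:R * tail F x) ^+ 2 <=
  pr (\bigcup_(i < n) [set w | x < X i w]).
Proof.
move=> x0; elim: n => [|n IHn].
  by rewrite !mul0r expr0n/= mulr0 subrr prob_ge0.
have mA i : measurable [set w | x < X i w] by exact: measurable_RV_gt.
have recr (B : nat -> set T) m :
    \bigcup_(i < m.+1) B i = \bigcup_(i < m) B i `|` B m.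
  by rewrite bigcup_mkord big_ord_recr/= -bigcup_mkord.
rewrite (recr (fun i => [set w | x < X i w])).
set U := \bigcup_(i < n) _ in IHn *; set A := [set w | x < X n w].
have mU : measurable U by exact: bigcup_measurable.
have UA : pr (U `&` A) <= n%:R * (M * tail F x ^+ 2).
  have -> : U `&` A = \bigcup_(i < n) ([set w | x < X i w] `&` A).
    by rewrite /U setI_bigcupl.
  apply: le_trans (prob_bigcup_ord_le _ _ _) _.
    by move=> i; exact: measurableI (mA i) (mA n).
  apply: le_trans (_ : \sum_(i < n) (M * tail F x ^+ 2) <= _).
    by apply: ler_sum => i _; apply: ENOD_pair => //; exact: ltn_ord.
  by rewrite sumr_const card_ord mulr_natl.
have : pr U + pr A <= pr (U `|` A) + pr (U `&` A).
  have mAn : measurable A by exact: mA.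
  have mUA : measurable (U `|` A) by exact: measurableU.
  have mIA : measurable (U `&` A) by exact: measurableI.
  have mD : measurable (A `\` U) by exact: measurableD.
  have hA := prob_le_setD P mAn mU.
  have : pr U + pr (A `\` U) <= pr (U `|` A).
    rewrite -lee_fin EFinD -!probE// -measureU//; last exact: setDIK.
    apply: le_measure; rewrite ?inE//; first exact: measurableU.
    by apply: setUS; exact: subDsetl.
  by move: hA; rewrite [A `&` U]setIC; lra.
rewrite (prob_RV_gt XF) -natr1 => h.
have := mulr_ge0 (mulr_ge0 (ltW M0) (ler0n R n)) (sqr_ge0 (tail F x)).
have := mulr_ge0 (ltW M0) (sqr_ge0 (tail F x)).
move: IHn UA h; nra.
Qed.

(** If one summand exceeds [(1 + theta) * x] while the sum stays below its mean
    plus [x], then the truncated summands have a deficit of order [x], whichever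
    summand was large; so no joint bound on a large summand and a small rest is
    called for, which orthant dependence would not provide. *)
Lemma large_deviation_lower theta gam e : consistently_varying F ->
  0 < theta -> 0 < gam -> 0 < e ->
  exists x0 : R, 0 < x0 /\ forall x n, x0 <= x -> (0 < n)%N -> gam * n%:R <= x ->
    (1 - e) * (n%:R * tail F ((1 + theta) * x)) <=
    pr [set w | n%:R * mu + x < \sum_(i < n) X i w].
Proof.
move=> CF th0 gam0 e0.
have eta0 : 0 < gam * theta / 2 by rewrite divr_gt0// mulr_gt0.
have [K [C [k [K0 C0 k0 hlow]]]] := truncated_sum_lower eta0.
pose kap := k * theta / (2 * mu) / (1 + theta).
have th1 : 0 < 1 + theta by lra.
have kap0 : 0 < kap by rewrite divr_gt0// divr_gt0// mulr_gt0.
have [z1 [z10 hz1]] := expRN_tail CF kap0 (divr_gt0 (divr_gt0 e0 (ltr0Sn R 1)) C0).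
have eM : 0 < e / (2 * M) * gam by rewrite mulr_gt0 ?divr_gt0 ?mulr_gt0.
have [z2 [z20 hz2]] := mul_tail_cvg0 Fpos Fmu eM.
exists (Num.max (2 * K / theta) (Num.max z1 z2)); split.
  by rewrite lt_max divr_gt0 ?mulr_gt0.
move=> x n; rewrite !ge_max => /and3P[xK xz1 xz2] n0 nx.
have x0 : 0 < x by lra.
set y := (1 + theta) * x.
have xy : x <= y by rewrite ler_peMl//; lra.
set N := n%:R in nx *.
have N1 : 1 <= N :> R by rewrite ler1n.
pose U := \bigcup_(i < n) [set w | y < X i w].
pose V := [set w | \sum_(i < n) Num.min (X i w) K <= N * mu - theta * x + K].
pose W := [set w | N * mu + x < \sum_(i < n) X i w].
have mU : measurable U by apply: bigcup_measurable => i _; exact: measurable_RV_gt.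
have mV : measurable V by apply: measurable_le; exact: measurable_sum_trunc.
have mW : measurable W by apply: measurable_gt; exact: measurable_partial_sum.
have hU := prob_max_lower n (le_trans (ltW x0) xy).
have UVW : pr U <= pr W + pr V.
  apply: le_trans (probU_le _ mW mV); apply: (le_prob_nonneg XF Fpos) => //.
    exact: measurableU.
  move=> w Nw [i /= iN yi]; have [h|h] := ltP (N * mu + x) (\sum_(i < n) X i w).
    by left.
  right; rewrite /V/=.
  move: h; rewrite (bigD1 (Ordinal iN))//= => h.
  rewrite (bigD1 (Ordinal iN))//=.
  have h1 : \sum_(j < n | j != Ordinal iN) Num.min (X j w) K <=
      \sum_(j < n | j != Ordinal iN) X j w.
    by apply: ler_sum => j _; rewrite ge_min lexx.
  have h2 : Num.min (X i w) K <= K by rewrite ge_min lexx orbT.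
  have yE : y = x + theta * x by rewrite /y; ring.
  by move: yi; rewrite yE; lra.
have txK : K <= theta * x / 2.
  by move: xK; rewrite ler_pdivrMr// => ?; lra.
have pV : pr V <= e / 2 * tail F y.
  have [Nmu|Nmu] := ltP (N * mu) (theta * x / 2).
    apply: le_trans (_ : pr set0 <= _).
      apply: (le_prob_nonneg XF Fpos) => // w Nw; rewrite /V/= => h.
      have : 0 <= \sum_(i < n) Num.min (X i w) K.
        by apply: sumr_ge0 => i _; rewrite le_min Nw ltW.
      lra.
    by rewrite /prob measure0 mulr_ge0 ?tail_ge0// divr_ge0// ltW.
  apply: le_trans (_ : C * expR (- k) ^+ n <= _).
    apply: le_trans (hlow n); apply: le_prob => //.
      by apply: measurable_le; exact: measurable_sum_trunc.
    move=> w; rewrite /V/= => /le_trans; apply.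
    rewrite -/N mulrBr.
    have : N * (gam * theta / 2) <= x * (theta / 2).
      by rewrite -mulrA mulrA ler_wpM2r//; [lra|rewrite mulrC].
    by move: txK; lra.
  rewrite -expRM_natr mulrC -ler_pdivlMr//.
  have := hz1 y (le_trans xz1 xy).
  have -> : e / 2 / C * tail F y = e / 2 * tail F y / C by ring.
  apply: le_trans; rewrite ler_expR mulNr lerN2.
  have -> : kap * y = k * (theta * x / 2 / mu).
    by rewrite /kap /y; field; rewrite !gt_eqF.
  by rewrite ler_pM2l// ler_pdivrMr.
have q_le : M * (N * tail F y) <= e / 2.
  have h := hz2 y (le_trans xz2 xy).
  have NG : gam * (N * tail F y) <= y * tail F y.
    by rewrite mulrA ler_wpM2r ?tail_ge0//; apply: le_trans xy.
  have : gam * (N * tail F y) <= e / (2 * M) * gam by apply: le_trans h.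
  rewrite mulrC ler_pM2r// => /(ler_wpM2l (ltW M0)).
  have -> // : M * (e / (2 * M)) = e / 2 by field; rewrite gt_eqF.
have q0 : 0 <= N * tail F y by rewrite mulr_ge0// tail_ge0.
have Fy := tail_ge0 F y.
rewrite -/W; move: hU UVW pV; rewrite -/N -/U.
have h1 : M * (N * tail F y) ^+ 2 <= e / 2 * (N * tail F y).
  have -> : M * (N * tail F y) ^+ 2 = M * (N * tail F y) * (N * tail F y) by ring.
  exact: ler_wpM2r.
have h2 : e / 2 * tail F y <= e / 2 * (N * tail F y).
  by rewrite ler_pM2l ?divr_gt0// ler_peMl.
lra.
Qed.

End LowerBounds.

End LargeDeviations.

(** * The renewal process and the net loss, path by path *)

Section RenewalPaths.
Context d (T : measurableType d) (R : realType) (P : probability T R).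
Context (Y Z : nat -> {RV P >-> R}) (c : R).

Local Notation Sy n w := (\sum_(i < n) Y i w).
Local Notation Sz n w := (\sum_(i < n) Z i w).

Lemma measurable_renewal_count t : measurable_fun setT (renewal_count Z t).
Proof.
rewrite /renewal_count.
have -> : (fun w => \sum_(1 <= n <oo) (\1_[set v | (Sz n v <= t)%R] w : R)%:E)%E =
    (fun w => \sum_(n <oo | n \in (leq 1)) (\1_[set v | (Sz n v <= t)%R] w : R)%:E)%E.
  by apply/funext => w; rewrite eseries_cond.
apply: ge0_emeasurable_sum => [n w _ _|n _]; first by rewrite lee_fin.
apply/measurable_EFinP; apply: measurable_indic.
by apply: measurable_le; exact: measurable_partial_sum.
Qed.

Lemma measurable_net_loss t : measurable_fun setT (net_loss Y Z c t).
Proof.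
pose N w := Num.truncn (fine (renewal_count Z t w)).
have mf : measurable_fun setT (fun w => fine (renewal_count Z t w)).
  by apply: measurableT_comp (measurable_renewal_count t).
have mN k : measurable [set w | N w = k].
  have -> : [set w | N w = k] = [set w | fine (renewal_count Z t w) < k.+1%:R]
      `\` [set w | fine (renewal_count Z t w) < k%:R].
    have N0 w : 0 <= fine (renewal_count Z t w).
      by apply/fine_ge0/nneseries_ge0 => n _ _; rewrite lee_fin.
    apply/seteqP; split => w /=; rewrite /N.
      move=> /eqP; rewrite truncn_eq// => /andP[h1 h2]; split => //.
      by apply/negP; rewrite -leNgt.
    move=> [h1 /negP]; rewrite -leNgt => h2.
    by apply/eqP; rewrite truncn_eq// h2.
  by apply: measurableD; exact: measurable_lt.
have mR k : measurable_fun setT (fun w => \sum_(i < k) (Y i w - c * Z i w)).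
  apply: measurable_sum => i; apply: measurable_funB; first exact: measurable_RV.
  by apply: measurable_funM => //; exact: measurable_RV.
move=> _ B mB; rewrite setTI.
have -> : net_loss Y Z c t @^-1` B = \bigcup_k ([set w | N w = k] `&`
    [set w | B (\sum_(i < k) (Y i w - c * Z i w))]).
  apply/seteqP; split => w /=; first by move=> Bw; exists (N w).
  by move=> [k _ [/= <-]].
apply: bigcup_measurable => k _; apply: measurableI => //.
by rewrite -[X in measurable X]setTI; exact: mR.
Qed.

Lemma partial_sum_mono (w : T) m n : (forall i, 0 <= Z i w) -> (m <= n)%N ->
  Sz m w <= Sz n w.
Proof.
move=> Z0 mn; rewrite -(subnKC mn) big_split_ord/= lerDl.
by apply: sumr_ge0.
Qed.

Lemma renewal_count_eq t w k : (forall i, 0 <= Z i w) ->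
  Sz k w <= t -> t < Sz k.+1 w -> renewal_count Z t w = k%:R%:E.
Proof.
move=> Z0 kt tk; apply/cvg_lim => //; apply: cvg_near_cst.
exists k.+1 => // m /= km.
rewrite (big_cat_nat _ _ (n := k.+1))//= [X in (_ + X)%E](_ : _ = 0%E); last first.
  rewrite big_nat_cond big1// => n; rewrite andbT => /andP[kn _].
  rewrite indicE memNset//=.
  by apply/negP; rewrite -ltNge; apply: lt_le_trans tk _; exact: partial_sum_mono.
rewrite adde0 (eq_big_nat _ _ (F2 := fun=> 1%:E)) => [|n /andP[_ nk]].
  rewrite sumEFin; congr EFin.
  by rewrite big_const_nat subSS subn0 iter_addr_0.
rewrite indicE mem_set//=.
by apply: le_trans kt; exact: partial_sum_mono.
Qed.

Lemma renewal_count_infty t w : (forall n, Sz n w <= t) ->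
  renewal_count Z t w = +oo%E.
Proof.
move=> ht; apply: eq_infty => r.
pose m := Num.bound `|r|.
have rm : r <= m%:R.
  by apply: le_trans (ler_norm r) _; apply/ltW/archi_boundP.
apply: le_trans (_ : (\sum_(1 <= i < m.+1) (1 : R)%:E <= _)%E).
  by rewrite sumEFin lee_fin big_const_nat subSS subn0 iter_addr_0.
rewrite (eq_big_nat _ _
  (F2 := fun n => (\1_[set v | (Sz n v <= t)%R] w : R)%:E)) => [|n _].
  by apply: nneseries_lim_ge => n _ _; rewrite lee_fin.
by rewrite indicE mem_set//; exact: ht.
Qed.

(** The renewal times start at [0 <= t] and do not decrease, so either a first one
    exceeds [t], or none does. *)
Lemma net_loss_cases t w : (forall i, 0 <= Z i w) -> 0 <= t ->
  (exists n, [/\ Sz n w <= t, t < Sz n.+1 w &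
     net_loss Y Z c t w = Sy n w - c * Sz n w]) \/
  ((forall n, Sz n w <= t) /\ net_loss Y Z c t w = 0).
Proof.
move=> Z0 t0; have [h|/existsNP[m hm]] := pselect (forall n, Sz n w <= t).
  right; split => //.
  by rewrite /net_loss renewal_count_infty//= truncn0 big_ord0.
left.
have ex : exists n, t < Sz n w by exists m; rewrite ltNge; exact/negP.
have [n tn nmin] := ex_minnP ex.
case: n tn nmin => [|n] tn nmin; first by move: tn; rewrite big_ord0 ltNge t0.
have nt : Sz n w <= t by rewrite leNgt; apply/negP => /nmin; rewrite ltnn.
exists n; split => //.
by rewrite /net_loss (renewal_count_eq Z0 nt tn)/= natrK sumrB mulr_sumr.
Qed.

End RenewalPaths.

(** * Asymptotics of the main term *)

(** Counts that bracket the number of renewals up to time [t]. *)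
Definition few_renewals (R : realType) (muH delta t : R) : nat :=
  Num.truncn ((1 - delta) * (t / muH)).

Definition many_renewals (R : realType) (muH delta t : R) : nat :=
  Num.truncn (t / muH / (1 - delta)).

Section Counts.
Context (R : realType) (muH delta : R).
Hypothesis muH0 : 0 < muH.
Hypothesis delta01 : 0 < delta < 1.

Lemma few_renewals_le t : 0 <= t ->
  (few_renewals muH delta t)%:R <= (1 - delta) * (t / muH).
Proof.
by move=> t0; case/andP: delta01 => _; rewrite -subr_gt0 truncn_le => d1; nneg.
Qed.

Lemma few_renewals_le1 t : 0 <= t -> (few_renewals muH delta t)%:R <= t / muH.
Proof.
move=> t0; case/andP: delta01 => d0 d1; apply: le_trans (few_renewals_le t0) _.
by rewrite ler_piMl ?gerBl// ?(ltW d0)//; nneg.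
Qed.

Lemma few_renewals_gt t : (1 - delta) * (t / muH) - 1 < (few_renewals muH delta t)%:R.
Proof. by rewrite ltrBlDr natr1; exact: truncnS_gt. Qed.

Lemma many_renewals_le t : 0 <= t ->
  (many_renewals muH delta t)%:R <= t / muH / (1 - delta).
Proof.
by move=> t0; case/andP: delta01 => _; rewrite -subr_gt0 truncn_le => d1; nneg.
Qed.

End Counts.

Section TailContinuity.
Context (R : realType) (G : probability R R).
Hypothesis CG : consistently_varying G.

Lemma tail_shrink (e : R) : 0 < e -> exists theta z0 : R,
  [/\ 0 < theta < 1, 0 < z0 & forall z, z0 <= z ->
     tail G ((1 - theta) * ((1 - theta) * z)) <= (1 + e) * tail G z].
Proof.
move=> e0; have [rho [z0 [rho1 z00 h]]] := consistently_varying_lower CG e0.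
pose theta := (1 - rho^-1) / 2.
have rhoV : 0 < rho^-1 by rewrite invr_gt0; lra.
have rhoV1 : rho^-1 < 1 by rewrite invf_lt1; lra.
have th0 : 0 < theta by rewrite /theta; lra.
have th1 : 0 < 1 - theta by rewrite /theta; lra.
exists theta, (z0 / ((1 - theta) * (1 - theta))); split.
- by apply/andP; split; lra.
- by pos.
move=> z; rewrite ler_pdivrMr; last by pos.
rewrite mulrC -mulrA => zz; have z_gt0 : 0 < z.
  by move: (lt_le_trans z00 zz); rewrite !pmulr_rgt0.
apply: le_trans (ltW (h _ zz)) _; rewrite ler_pM2l; last lra.
apply: le_tail.
have -> : rho * ((1 - theta) * ((1 - theta) * z)) =
    rho * ((1 - theta) * (1 - theta)) * z by ring.
apply: ler_peMl (ltW z_gt0) _; rewrite -(ler_pM2l rhoV) mulKf; last by lra.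
have : rho^-1 = 1 - 2 * theta by rewrite /theta; lra.
by move=> ->; nra.
Qed.

Lemma tail_stretch (e : R) : 0 < e -> exists theta z0 : R,
  [/\ 0 < theta, 0 < z0 & forall z, z0 <= z ->
     tail G z <= (1 + e) * tail G ((1 + theta) * ((1 + theta) * z))].
Proof.
move=> e0; have [rho [z0 [rho1 z00 h]]] := consistently_varying_lower CG e0.
pose theta := Num.min 1 ((rho - 1) / 3).
have th0 : 0 < theta by rewrite lt_min ltr01 divr_gt0// subr_gt0.
have th1 : theta <= 1 by rewrite ge_min lexx.
have thr : theta <= (rho - 1) / 3 by rewrite ge_min lexx orbT.
exists theta, z0; split => // z zz; have z_gt0 := lt_le_trans z00 zz.
apply: le_trans (ltW (h _ zz)) _; rewrite ler_pM2l; last lra.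
apply: le_tail; rewrite mulrA ler_pM2r//; nra.
Qed.

(** The claims as their own reference tail in the large-deviation bounds. *)
Lemma tail_self x : 0 <= x -> tail G x <= 1 * tail G x.
Proof. by rewrite mul1r. Qed.

End TailContinuity.

(** The level that the claims have to exceed beyond their mean is that of the
    net loss, up to a fraction [theta], once the brackets are tight enough. *)
Lemma bracket_level_upper (R : realType) (m muH c delta theta t x k k1 : R) :
  0 < m -> 0 < muH -> 0 < c -> 0 < delta -> 0 < t -> 0 <= x ->
  delta <= 1 / 2 -> 0 <= theta ->
  delta * (3 * c + 2 * m) <= theta * (c - m) -> muH <= delta * t ->
  (1 - delta) * (t / muH) - 1 < k1 -> k <= t / muH / (1 - delta) ->
  (1 - theta) * (x + (c - m) * t) <= x + c * (1 - delta) * muH * k1 - k * (m * muH).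
Proof.
move=> m0 muH0 c0 d0 t0 x0 d2 th0 dth Ht hk1 hk.
have h1 : (1 - delta) * t - muH <= muH * k1.
  have -> : (1 - delta) * t - muH = muH * ((1 - delta) * (t / muH) - 1).
    by field; rewrite gt_eqF.
  by rewrite ler_pM2l// ltW.
have h2 : k * (m * muH) <= (1 + 2 * delta) * (m * t).
  apply: le_trans (_ : t / muH / (1 - delta) * (m * muH) <= _).
    by rewrite ler_pM2r// mulr_gt0.
  have -> : t / muH / (1 - delta) * (m * muH) = (1 - delta)^-1 * (m * t).
    by field; rewrite !gt_eqF//; lra.
  have h : 0 <= delta * (1 - 2 * delta) by apply: mulr_ge0; lra.
  by rewrite ler_pM2r ?mulr_gt0// -[leLHS]mul1r ler_pdivrMr; lra.
have h3 : c * (1 - delta) * ((1 - 2 * delta) * t) <= c * (1 - delta) * (muH * k1).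
  by rewrite ler_pM2l; [lra|apply: mulr_gt0 => //; lra].
have h4 : (1 - 3 * delta) * t <= (1 - delta) * ((1 - 2 * delta) * t).
  by have := mulr_ge0 (mulr_ge0 (ltW d0) (ltW d0)) (ltW t0); lra.
have h5 := ler_wpM2l (ltW c0) h4.
have h6 := ler_wpM2r (ltW t0) dth.
have h7 := mulr_ge0 th0 x0.
lra.
Qed.

Lemma bracket_level_lower (R : realType) (m muH c delta theta t x k : R) :
  0 < m -> 0 < muH -> 0 < t -> 0 <= x -> 0 < theta ->
  delta * (2 * m) <= theta * (c - m) ->
  1 <= delta * (t / muH) -> (1 - delta) * (t / muH) - 1 < k -> k <= t / muH ->
  x + (c - m) * t <= x + c * t - k * (m * muH) <= (1 + theta) * (x + (c - m) * t).
Proof.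
move=> m0 muH0 t0 x0 th0 dth Ht hk1 hk.
have mH : 0 < m * muH by rewrite mulr_gt0.
have h1 : k * (m * muH) <= m * t.
  apply: le_trans (_ : t / muH * (m * muH) <= _); first by rewrite ler_pM2r.
  by rewrite le_eqVlt; apply/orP; left; apply/eqP; field; rewrite gt_eqF.
have h2 : (1 - 2 * delta) * (m * t) <= k * (m * muH).
  have -> : (1 - 2 * delta) * (m * t) = (1 - 2 * delta) * (t / muH) * (m * muH).
    by field; rewrite gt_eqF.
  by rewrite ler_pM2r//; lra.
have h3 := ler_wpM2r (ltW t0) dth.
have h4 := mulr_ge0 (ltW th0) x0.
by apply/andP; split; lra.
Qed.

Lemma cube_le (R : realType) (e : R) : 0 < e -> exists2 e1 : R, 0 < e1 <= 1 / 2 &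
  (1 + e1) ^+ 3 <= 1 + e /\ 1 - e <= (1 - e1) ^+ 3.
Proof.
move=> e0; pose e1 := Num.min (1 / 2) (e / 7).
have h0 : 0 < e1 by rewrite lt_min !divr_gt0.
have h1 : e1 <= 1 / 2 by rewrite ge_min lexx.
have h2 : e1 <= e / 7 by rewrite ge_min lexx orbT.
have h3 : e1 ^+ 2 <= e1 by nra.
have h4 : 0 <= e1 ^+ 3 <= e1 by rewrite exprS; apply/andP; split; nra.
exists e1; first by rewrite h0.
have -> : (1 + e1) ^+ 3 = 1 + 3 * e1 + 3 * e1 ^+ 2 + e1 ^+ 3 by ring.
have -> : (1 - e1) ^+ 3 = 1 - 3 * e1 + 3 * e1 ^+ 2 - e1 ^+ 3 by ring.
by have := sqr_ge0 e1; move: h4 => /andP[]; split; lra.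
Qed.

Section ClaimAsymptotics.
Context d (T : measurableType d) (R : realType) (P : probability T R).
Context (Y : nat -> {RV P >-> R}) (G : probability R R) (muG muH c MG : R).
Local Notation pr := (prob P).
Hypothesis YG : common_distribution Y G.
Hypothesis Gpos : nonneg_supported G.
Hypothesis Gmu : has_mean G muG.
Hypothesis muG0 : 0 < muG.
Hypothesis muH0 : 0 < muH.
Hypothesis c0 : 0 < c.
Hypothesis load : muG < c * muH.
Hypothesis MG0 : 0 < MG.
Hypothesis YM : ENOD Y MG.
Hypothesis CG : consistently_varying G.

Local Notation b := (c - muG / muH).
Local Notation n1 delta t := (few_renewals muH delta t).
Local Notation n2 delta t := (many_renewals muH delta t).

Lemma drift_gt0 : 0 < b.
Proof. by rewrite subr_gt0 ltr_pdivrMr. Qed.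

(** The sum of [n2] claims has to exceed its mean by [y], which is at least
    [(1 - theta) * u]; one claim above [(1 - theta) * y] is needed for that, and
    consistent variation absorbs both factors. *)
Lemma claims_upper e : 0 < e -> exists delta0 : R, 0 < delta0 /\
  forall delta, 0 < delta <= delta0 -> exists t0 : R, 0 < t0 /\
  forall t x, t0 <= t -> 0 <= x ->
    pr [set w | x + c * (1 - delta) * muH * (n1 delta t)%:R <
                \sum_(i < n2 delta t) Y i w] <=
    (1 + e) * (t / muH * tail G (x + b * t)).
Proof.
move=> e0; have [e1 /andP[e10 _] [e13 _]] := cube_le e0.
have e1p : 0 < 1 + e1 by rewrite addr_gt0.
have b0 := drift_gt0.
have [theta [z0 [th01 z00 hz]]] := tail_shrink CG e10.
have /andP[th0 th1] := th01.
have omth : 0 < 1 - theta by rewrite subr_gt0.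
pose m := 3 * c + 2 * (muG / muH).
have m0 : 0 < m by rewrite addr_gt0 ?mulr_gt0// invr_gt0.
exists (Num.min (1 / 2) (Num.min (e1 / (1 + e1)) (theta * b / m))); split.
  by rewrite !lt_min !divr_gt0// mulr_gt0.
move=> delta /andP[d0]; rewrite !le_min => /and3P[d2 de dth].
have omd : 0 < 1 - delta by rewrite subr_gt0 (le_lt_trans d2)// ltr_pdivrMr// mul1r ltr1n.
have d01 : 0 < delta < 1 by rewrite d0 -subr_gt0.
have gam0 : 0 < (1 - theta) * b * muH * (1 - delta) by rewrite !mulr_gt0.
have [x0 [x00 hx0]] := large_deviation_upper YG Gpos Gmu muG0 MG0 YM CG Gpos Gmu ltr01
  (tail_self G) th01 gam0 e10.
exists (Num.max (muH / delta) (Num.max (x0 / ((1 - theta) * b)) (z0 / b))).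
split; first by rewrite !lt_max divr_gt0.
move=> t x; rewrite !ge_max => /and3P[tm tx tz] xge0.
have tpos : 0 < t by apply: lt_le_trans tm; rewrite divr_gt0.
set u := x + b * t; set lt := t / muH.
have lt0 : 0 < lt by rewrite divr_gt0.
have ub : b * t <= u by rewrite lerDr.
have hk1 := few_renewals_gt muH delta t.
have hk2 : (n2 delta t)%:R <= lt / (1 - delta) := many_renewals_le muH0 d01 (ltW tpos).
set k1 := (n1 delta t)%:R in hk1 *; set k2 : R := (n2 delta t)%:R in hk2 *.
pose y := x + c * (1 - delta) * muH * k1 - k2 * muG.
have yu : (1 - theta) * u <= y.
  have mE : muG = muG / muH * muH by rewrite divfK ?gt_eqF.
  rewrite /y [in k2 * muG]mE; apply: bracket_level_upper => //.
  - by rewrite divr_gt0.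
  - exact: ltW.
  - by rewrite -ler_pdivlMr.
  - by rewrite mulrC -ler_pdivrMr.
have bty : (1 - theta) * (b * t) <= y by apply: le_trans yu; rewrite ler_pM2l.
have xy : x0 <= y.
  by apply: le_trans bty; rewrite mulrA mulrC -ler_pdivrMr// mulr_gt0.
have ky : (1 - theta) * b * muH * (1 - delta) * k2 <= y.
  apply: le_trans bty.
  have -> : (1 - theta) * (b * t) =
      (1 - theta) * b * muH * (1 - delta) * (lt / (1 - delta)).
    by rewrite /lt; field; rewrite !gt_eqF.
  by rewrite ler_pM2l.
have := hx0 y _ xy ky; rewrite -/k2.
have -> : k2 * muG + y = x + c * (1 - delta) * muH * k1 by rewrite /y; ring.
move=> /le_trans; apply.
have Gy : tail G ((1 - theta) * y) <= (1 + e1) * tail G u.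
  apply: le_trans (_ : tail G ((1 - theta) * ((1 - theta) * u)) <= _).
    by apply: le_tail; rewrite ler_pM2l.
  by apply: hz; apply: le_trans ub; rewrite mulrC -ler_pdivrMr.
have d_e : (1 - delta)^-1 <= 1 + e1.
  rewrite -[leLHS]mul1r ler_pdivrMr// mulrBr mulr1 lerBrDr mulrC lerD2l.
  by rewrite -ler_pdivlMr.
have k2e : k2 <= lt * (1 + e1) by apply: le_trans hk2 _; rewrite ler_pM2l.
have -> : k2 * tail G ((1 - theta) * y) + e1 * (k2 * tail G ((1 - theta) * y)) =
  (1 + e1) * (k2 * tail G ((1 - theta) * y)) by ring.
apply: le_trans (_ : (1 + e1) * (lt * (1 + e1) * ((1 + e1) * tail G u)) <= _).
  by rewrite ler_pM2l//; apply: ler_pM => //; exact: tail_ge0.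
have -> : (1 + e1) * (lt * (1 + e1) * ((1 + e1) * tail G u)) =
  (1 + e1) ^+ 3 * (lt * tail G u) by ring.
by apply: ler_wpM2r => //; rewrite mulr_ge0 ?tail_ge0// ltW.
Qed.

Lemma claims_lower e : 0 < e -> exists delta0 : R, 0 < delta0 /\
  forall delta, 0 < delta <= delta0 -> exists t0 : R, 0 < t0 /\
  forall t x, t0 <= t -> 0 <= x ->
    (1 - e) * (t / muH * tail G (x + b * t)) <=
    pr [set w | x + c * t < \sum_(i < n1 delta t) Y i w].
Proof.
move=> e0; have [e1 /andP[e10 e11] [_ e13]] := cube_le e0.
have ome : 0 < 1 - e1 by rewrite subr_gt0 (le_lt_trans e11)// ltr_pdivrMr// mul1r ltr1n.
have b0 := drift_gt0.
have [theta [z0 [th0 z00 hz]]] := tail_stretch CG e10.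
have th1 : 0 < 1 + theta by rewrite addr_gt0.
have mm0 : 0 < muG / muH by rewrite divr_gt0.
exists (Num.min (e1 / 2) (theta * b / (2 * (muG / muH)))); split.
  by rewrite lt_min; apply/andP; split; pos.
move=> delta /andP[d0]; rewrite !le_min => /andP[de dth].
have d2 : 2 * delta <= e1 by rewrite mulrC -ler_pdivlMr.
have dp : 0 < 1 - 2 * delta by rewrite (lt_le_trans ome)// lerD2l lerN2.
have d01 : 0 < delta < 1.
  by rewrite d0 -subr_gt0 (lt_trans dp)// ltrD2l ltrN2 ltr_pMl// ltr1n.
have gam0 : 0 < b * muH by rewrite mulr_gt0.
have [x0 [x00 hx0]] := large_deviation_lower YG Gpos Gmu muG0 MG0 YM CG th0 gam0 e10.
exists (Num.max (muH / delta) (Num.max (x0 / b) (z0 / b))).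
split; first by rewrite !lt_max divr_gt0.
move=> t x; rewrite !ge_max => /and3P[tm tx tz] xge0.
have tpos : 0 < t by apply: lt_le_trans tm; rewrite divr_gt0.
set u := x + b * t; set lt := t / muH.
have lt0 : 0 < lt by rewrite divr_gt0.
have ub : b * t <= u by rewrite lerDr.
have ltd : 1 <= delta * lt.
  by rewrite /lt mulrA ler_pdivlMr// mul1r mulrC -ler_pdivrMr.
have hk1 := few_renewals_gt muH delta t.
have k1_le : (n1 delta t)%:R <= lt := few_renewals_le1 muH0 d01 (ltW tpos).
set k1 : R := (n1 delta t)%:R in hk1 k1_le *.
have hk : (1 - 2 * delta) * lt <= k1.
  apply: le_trans (ltW hk1); rewrite -/lt !mulrBl !mul1r -addrA lerD2l.
  by rewrite -opprD lerN2 -mulrA mulr_natl mulr2n lerD2l.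
have k1_gt0 : (0 < n1 delta t)%N.
  by rewrite -(ltr_nat R); apply: lt_le_trans hk; rewrite mulr_gt0.
pose y := x + c * t - k1 * muG.
have uyb : u <= y <= (1 + theta) * u.
  have mE : muG = muG / muH * muH by rewrite divfK ?gt_eqF.
  rewrite /y [in k1 * muG]mE; apply: (bracket_level_lower (delta := delta)) => //.
  by rewrite -ler_pdivlMr// mulr_gt0.
have [uy yu] := andP uyb.
have xy : x0 <= y.
  by apply: le_trans uy; apply: le_trans ub; rewrite mulrC -ler_pdivrMr.
have ky : b * muH * k1 <= y.
  apply: le_trans uy; apply: le_trans ub; rewrite -mulrA ler_pM2l// mulrC.
  by rewrite -ler_pdivlMr.
have := hx0 y _ xy k1_gt0 ky; rewrite -/k1.
have -> : k1 * muG + y = x + c * t by rewrite /y; ring.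
apply: le_trans.
have zu : z0 <= u by apply: le_trans ub; rewrite mulrC -ler_pdivrMr.
have Gy : tail G u <= (1 + e1) * tail G ((1 + theta) * y).
  apply: le_trans (hz _ zu) _; rewrite ler_pM2l ?addr_gt0//.
  apply: le_trans (_ : tail G ((1 + theta) * ((1 + theta) * u)) <= _) => //.
  by apply: le_tail; rewrite ler_pM2l.
have Gy' : (1 - e1) * tail G u <= tail G ((1 + theta) * y).
  apply: le_trans (ler_wpM2l (ltW ome) Gy) _.
  rewrite mulrA ler_piMl ?tail_ge0// -subr_sqr expr1n.
  by rewrite gerBl sqr_ge0.
apply: le_trans (_ : (1 - e1) * ((1 - e1) * lt * ((1 - e1) * tail G u)) <= _).
  have -> : (1 - e1) * ((1 - e1) * lt * ((1 - e1) * tail G u)) =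
    (1 - e1) ^+ 3 * (lt * tail G u) by ring.
  by apply: ler_wpM2r => //; rewrite mulr_ge0 ?tail_ge0// ltW.
have Gu := tail_ge0 G u.
rewrite ler_pM2l//; apply: ler_pM => //.
- by rewrite mulr_ge0// ltW.
- by rewrite mulr_ge0// ltW.
- by apply: le_trans hk; rewrite ler_pM2r// lerD2l lerN2.
Qed.

End ClaimAsymptotics.

(** * Events generated by the claims and by the interarrival times *)

Section GeneratedEvents.
Context d (T : measurableType d) (R : realType) (P : probability T R).
Context (X : nat -> {RV P >-> R}).

Let Gen := \bigcup_i preimage_set_system setT (X i : T -> R) measurable.

Let measurable_gen_RV i :
  measurable_fun setT (X i : g_sigma_algebraType Gen -> R).
Proof.
move=> _ B mB; apply: sub_gen_smallest; exists i => //.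
by exists B.
Qed.

Lemma generated_sigma_sum n (B : set R) : measurable B ->
  generated_sigma (fun i => X i : T -> R) [set w | B (\sum_(i < n) X i w)].
Proof.
move=> mB.
have mS : measurable_fun setT
    (fun w : g_sigma_algebraType Gen => \sum_(i < n) X i w).
  by apply: measurable_sum => i; exact: measurable_gen_RV.
by have := mS measurableT B mB; rewrite setTI.
Qed.

Lemma generated_sigmaI (A B : set T) :
  generated_sigma (fun i => X i : T -> R) A ->
  generated_sigma (fun i => X i : T -> R) B ->
  generated_sigma (fun i => X i : T -> R) (A `&` B).
Proof. exact: (@measurableI _ (g_sigma_algebraType Gen)). Qed.

Lemma generated_sum_gt n r :
  generated_sigma (fun i => X i : T -> R) [set w | r < \sum_(i < n) X i w].
Proof.
have -> : [set w | r < \sum_(i < n) X i w] =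
    [set w | [set` `]r, +oo[] (\sum_(i < n) X i w)].
  by apply/seteqP; split => w /=; rewrite in_itv/= andbT.
exact: generated_sigma_sum.
Qed.

Lemma generated_sum_lt n r :
  generated_sigma (fun i => X i : T -> R) [set w | \sum_(i < n) X i w < r].
Proof. exact: (generated_sigma_sum n (measurable_itv `]-oo, r[)). Qed.

Lemma generated_sum_le n r :
  generated_sigma (fun i => X i : T -> R) [set w | \sum_(i < n) X i w <= r].
Proof. exact: (generated_sigma_sum n (measurable_itv `]-oo, r])). Qed.

End GeneratedEvents.

Lemma case1_independent d (T : measurableType d) (R : realType)
    (P : probability T R) (Y Z : nat -> {RV P >-> R}) (tau : {RV P >-> R})
    (A B : set T) : case1 Y Z tau ->
  measurable A -> measurable B ->
  generated_sigma (fun i => Y i : T -> R) A ->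
  generated_sigma (fun i => Z i : T -> R) B ->
  prob P (A `&` B) = prob P A * prob P B.
Proof.
move=> [ind _] mA mB gA gB.
pose i0 : 'I_3 := ord0; pose i1 : 'I_3 := lift ord0 ord0.
pose J : {fset 'I_3} := [fset i0; i1]%fset.
have := ind J (fun k => if k == i0 then A else B).
have -> : \bigcap_(j in [set` J]) (if j == i0 then A else B) = A `&` B.
  apply/seteqP; split => w.
    move=> h; split; first by have := h i0; rewrite /= !inE eqxx; apply.
    by have := h i1; rewrite /= !inE eqxx orbT; apply.
  by move=> [Aw Bw] j _; case: ifP.
rewrite big_fsetU1/= ?inE// big_seq_fset1 /= => h.
rewrite {1}/prob h; last first.
  by move=> j; rewrite !inE => /orP[] /eqP ->.
by rewrite fineM ?fin_num_measure.
Qed.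

(** * The net loss in the two dependence cases *)

Section TailComparison.
Context (R : realType) (G : probability R R).
Hypothesis CG : consistently_varying G.

Lemma tail_scale_le (B : R) : 0 < B -> exists C : R, 0 < C /\
  forall x, 0 <= x -> tail G x <= C * tail G (B * x).
Proof.
move=> B0; have [p hp] := tail_potter CG.
pose L := Num.max 1 B.
have L1 : 1 <= L by rewrite le_max lexx.
have L0 : 0 < 2 * L by rewrite mulr_gt0// (lt_le_trans ltr01).
exists ((2 * L) ^+ p); split; first by rewrite exprn_gt0.
move=> x x0; apply: le_trans (hp _ _ L1 x0) _.
rewrite ler_pM2l ?exprn_gt0//; apply: le_tail.
by rewrite ler_wpM2r// le_max lexx orbT.
Qed.

End TailComparison.

Section RenewalModel.
Context d (T : measurableType d) (R : realType) (P : probability T R).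
Context (Y Z : nat -> {RV P >-> R}) (G H : probability R R).
Context (muG muH c MG MH : R).
Local Notation pr := (prob P).
Hypothesis YG : common_distribution Y G.
Hypothesis Gpos : nonneg_supported G.
Hypothesis Gmu : has_mean G muG.
Hypothesis muG0 : 0 < muG.
Hypothesis ZH : common_distribution Z H.
Hypothesis Hpos : nonneg_supported H.
Hypothesis Hmu : has_mean H muH.
Hypothesis muH0 : 0 < muH.
Hypothesis c0 : 0 < c.
Hypothesis load : muG < c * muH.
Hypothesis MG0 : 0 < MG.
Hypothesis YM : ENOD Y MG.
Hypothesis CG : consistently_varying G.
Hypothesis MH0 : 0 < MH.
Hypothesis ZM : ENOD Z MH.
Hypothesis HG : tail H x / tail G x @[x --> +oo] --> 0.

Local Notation b := (c - muG / muH).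
Local Notation n1 delta t := (few_renewals muH delta t).
Local Notation n2 delta t := (many_renewals muH delta t).
Local Notation Sy n w := (\sum_(i < n) Y i w).
Local Notation Sz n w := (\sum_(i < n) Z i w).
Local Notation loss x t := [set w | x < net_loss Y Z c t w].
Local Notation early delta n := [set w | Sz n w < n%:R * (muH - delta * muH)].
Local Notation late delta t := [set w | t < Sz (n1 delta t) w].

Lemma measurable_Sy_gt n r : measurable [set w | r < Sy n w].
Proof. by apply: measurable_gt; exact: measurable_partial_sum. Qed.

Lemma measurable_Sz_gt n r : measurable [set w | r < Sz n w].
Proof. by apply: measurable_gt; exact: measurable_partial_sum. Qed.

Lemma measurable_Sz_le n r : measurable [set w | Sz n w <= r].
Proof. by apply: measurable_le; exact: measurable_partial_sum. Qed.

Lemma measurable_Sz_lt n r : measurable [set w | Sz n w < r].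
Proof. by apply: measurable_lt; exact: measurable_partial_sum. Qed.

Lemma measurable_loss x t : measurable (loss x t).
Proof. by apply: measurable_gt; exact: measurable_net_loss. Qed.

Lemma measurable_infinitely t : measurable [set w | forall n, Sz n w <= t].
Proof.
have -> : [set w | forall n, Sz n w <= t] = \bigcap_n [set w | Sz n w <= t].
  by apply/seteqP; split => [w hw n _|w hw n]; [exact: hw|exact: (hw n I)].
by apply: bigcap_measurable => // n _; exact: measurable_Sz_le.
Qed.

Lemma le_prob_model A B : measurable A -> measurable B ->
  (forall w, (forall i, 0 <= Y i w) -> (forall i, 0 <= Z i w) -> A w -> B w) ->
  pr A <= pr B.
Proof.
move=> mA mB AB; have mN := measurable_nonneg_event Z.
have mI : measurable (A `&` nonneg_event Z) by exact: measurableI.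
apply: le_trans (le_prob_nonneg ZH Hpos mA mI _) _; first by [].
by apply: (le_prob_nonneg YG Gpos) => // w Yw [Aw Zw]; exact: AB.
Qed.

Lemma interarrival_tail e : 0 < e -> exists x0 : R, 0 < x0 /\
  forall x, x0 <= x -> tail H x <= e * tail G x.
Proof.
move=> e0; move/cvgrPdist_le : HG => /(_ _ e0)[M [_ hM]].
exists (Num.max 1 (M + 1)); split; first by rewrite lt_max ltr01.
move=> x; rewrite ge_max => /andP[x1 xM].
have G0 := consistently_varying_gt0 CG x.
have := hM x; rewrite /= sub0r normrN => /(_ _).
rewrite ger0_norm ?divr_ge0 ?tail_ge0// ler_pdivrMr//; apply.
by apply: lt_le_trans xM; rewrite ltrDl.
Qed.

Lemma interarrival_tail_dominated : exists C0 : R, 0 < C0 /\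
  forall x, 0 <= x -> tail H x <= C0 * tail G x.
Proof.
have [x0 [x00 h]] := interarrival_tail ltr01.
have G0 := consistently_varying_gt0 CG x0.
exists (Num.max 1 (tail G x0)^-1); split; first by rewrite lt_max ltr01.
move=> x xge0; have [xx|xx] := leP x0 x.
  apply: le_trans (h _ xx) _; rewrite ler_wpM2r ?tail_ge0// le_max lexx//.
apply: le_trans (tail_le1 _ _) _.
apply: le_trans (_ : (tail G x0)^-1 * tail G x <= _).
  by rewrite mulrC ler_pdivlMr// mul1r le_tail// ltW.
by rewrite ler_wpM2r ?tail_ge0// le_max lexx orbT.
Qed.

(** Interarrival times are so light compared with the claims that a large
    deviation of their sum is negligible on the scale of the claims. *)
Lemma interarrival_upper gam e : 0 < gam -> 0 < e -> exists x0 : R, 0 < x0 /\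
  forall x n, x0 <= x -> gam * n%:R <= x ->
    pr [set w | n%:R * muH + x < Sz n w] <= e * (n%:R * tail G (1 / 2 * x)).
Proof.
move=> gam0 e0; have e20 : 0 < e / 2 by rewrite divr_gt0.
have [C0 [C00 hC]] := interarrival_tail_dominated.
have th : 0 < (1 / 2 : R) < 1 by apply/andP; split; lra.
have [x0 [x00 h]] := large_deviation_upper ZH Hpos Hmu muH0 MH0 ZM CG Gpos Gmu C00
  hC th gam0 e20.
have [x1 [x10 h1]] := interarrival_tail e20.
exists (Num.max x0 (2 * x1)); split; first by rewrite lt_max x00.
move=> x n; rewrite ge_max => /andP[xx0 xx1] nx.
apply: le_trans (h x n xx0 nx) _.
have -> : (1 - 1 / 2) * x = 1 / 2 * x by lra.
have : tail H (1 / 2 * x) <= e / 2 * tail G (1 / 2 * x) by apply: h1; lra.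
move=> /(ler_wpM2l (ler0n R n)); lra.
Qed.

Lemma early_exponential delta : 0 < delta -> exists C k : R, [/\ 0 < C, 0 < k &
  forall n, pr (early delta n) <= C * expR (- k) ^+ n].
Proof.
move=> d0; have [C [k [C0 k0 h]]] :=
  partial_sum_lower ZH Hpos Hmu MH0 ZM (mulr_gt0 d0 muH0).
exists C, k; split => // n; apply: le_trans (h n); apply: le_prob.
- exact: measurable_Sz_lt.
- exact: measurable_Sz_le.
- by move=> w /= /ltW.
Qed.

(** Fewer than [(1 - delta) * t / muH] renewals mean that this many interarrival
    times exceed their mean by [delta * t]. *)
Lemma late_small delta e : 0 < delta < 1 -> 0 < e -> exists t0 : R, 0 < t0 /\
  forall t, t0 <= t ->
    pr (late delta t) <= e * (t / muH * tail G (1 / 2 * (delta * t))).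
Proof.
move=> d01 e0; have /andP[d0 d1] := d01.
have [x0 [x00 h]] := interarrival_upper (mulr_gt0 d0 muH0) e0.
exists (x0 / delta); split; first by rewrite divr_gt0.
move=> t tx.
have t0 : 0 < t by apply: lt_le_trans tx; rewrite divr_gt0.
have k1 := few_renewals_le muH0 d01 (ltW t0).
have k1' := few_renewals_le1 muH0 d01 (ltW t0).
have dt : x0 <= delta * t by rewrite mulrC -ler_pdivrMr.
have kd : delta * muH * (n1 delta t)%:R <= delta * t.
  by rewrite -mulrA ler_pM2l// mulrC -ler_pdivlMr.
apply: le_trans (_ : e * ((n1 delta t)%:R * tail G (1 / 2 * (delta * t))) <= _).
  apply: le_trans (h _ _ dt kd); apply: le_prob.
  - exact: measurable_Sz_gt.
  - exact: measurable_Sz_gt.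
  move=> w /=; apply: le_lt_trans.
  move: k1; rewrite -(ler_pM2r muH0).
  have -> : (1 - delta) * (t / muH) * muH = t - delta * t by field; rewrite gt_eqF.
  by rewrite lerBrDr.
by rewrite ler_pM2l// ler_wpM2r// tail_ge0.
Qed.

Lemma late_cvg0 delta e : 0 < delta < 1 -> 0 < e -> exists t0 : R, 0 < t0 /\
  forall t, t0 <= t -> pr (late delta t) <= e.
Proof.
move=> d01 e0; have /andP[d0 d1] := d01.
have [t0 [t00 h]] := late_small d01 ltr01.
have a0 : 0 < e * muH * (delta / 2) by pos.
have [x0 [x00 h0]] := mul_tail_cvg0 Gpos Gmu a0.
exists (Num.max t0 (2 * x0 / delta)); split; first by rewrite lt_max t00.
move=> t; rewrite ge_max => /andP[tt tx].
apply: le_trans (h t tt) _; set x := 1 / 2 * (delta * t); rewrite mul1r.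
have xx : x0 <= x.
  by move: tx; rewrite ler_pdivrMr// /x; lra.
have := h0 x xx.
have -> : t / muH * tail G x = x * tail G x / (muH * (delta / 2)).
  by rewrite {2}/x; field; rewrite !gt_eqF.
move=> hx; rewrite ler_pdivrMr; last by pos.
by rewrite mulrA.
Qed.

(** On this event [net_loss] is an empty sum, however large the claims. For all
    large [n] the event lies in [early (1 / 2) n], whose probability tends to [0]. *)
Lemma infinitely_many_null t : 0 <= t -> pr [set w | forall n, Sz n w <= t] = 0.
Proof.
move=> t0; apply: le_anti; rewrite prob_ge0 andbT leNgt; apply/negP.
set p := pr _ => p0.
have d20 : 0 < (1 / 2 : R) by lra.
have [C [k [C0 k0 h]]] := early_exponential d20.
have mI := measurable_infinitely t.
pose m := (maxn (Num.bound (2 * t / muH)) (Num.bound (C / p / k))).+1.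
have m1 : 2 * t / muH < m%:R.
  apply: lt_le_trans (archi_boundP _) _; first by nneg.
  by rewrite ler_nat leqW// leq_maxl.
have m2 : C / p / k < m%:R.
  apply: lt_le_trans (archi_boundP _) _; first by nneg.
  by rewrite ler_nat leqW// leq_maxr.
have : p <= C * expR (- k) ^+ m.
  apply: le_trans (h m); apply: le_prob => //; first exact: measurable_Sz_lt.
  move=> w /= /(_ m) /le_lt_trans; apply.
  by move: m1; rewrite ltr_pdivrMr//; lra.
rewrite -expRM_natl mulrN expRN ler_pdivlMr ?expR_gt0// => hp.
have : m%:R * k < expR (m%:R * k).
  by apply: lt_le_trans (expR_ge1Dx _); rewrite ltrDr.
rewrite -(ltr_pM2l p0); move: m2; rewrite !ltr_pdivrMr// => m2 hq.
have := lt_le_trans hq hp.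
by rewrite ltNge mulrC ltW.
Qed.

(** * Path-wise comparison with the bracketing counts *)

(** Here [Sz n w <= t] bounds the number [n] of renewals from above, because the
    interarrival times are not too short on average. *)
Lemma partial_sum_bracket delta t x n w : 0 < delta < 1 ->
  (forall i, 0 <= Y i w) ->
  Sz n w <= t -> x < Sy n w - c * Sz n w -> (n1 delta t <= n)%N ->
  n%:R * (muH - delta * muH) <= Sz n w ->
  x + c * (1 - delta) * muH * (n1 delta t)%:R < Sy (n2 delta t) w.
Proof.
move=> /andP[d0 d1] Y0 nt xS n1n nE.
have dH : 0 < (1 - delta) * muH by rewrite mulr_gt0// subr_gt0.
have nE' : n%:R * ((1 - delta) * muH) <= Sz n w by rewrite mulrBl mul1r.
have nn2 : (n <= n2 delta t)%N.
  have h : n%:R <= t / muH / (1 - delta).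
    have -> : t / muH / (1 - delta) = t / ((1 - delta) * muH).
      by field; rewrite !gt_eqF// subr_gt0.
    by rewrite ler_pdivlMr//; apply: le_trans nt.
  by rewrite truncn_ge_nat// (le_trans _ h).
have h1 : Sy n w <= Sy (n2 delta t) w by exact: partial_sum_mono.
have h2 : c * (n%:R * ((1 - delta) * muH)) <= c * Sz n w by rewrite ler_pM2l.
have h3 : (n1 delta t)%:R * ((1 - delta) * muH) <= n%:R * ((1 - delta) * muH).
  by rewrite ler_pM2r// ler_nat.
have := h3; rewrite -(ler_pM2l c0) => h4.
have -> : c * (1 - delta) * muH * (n1 delta t)%:R =
  c * ((n1 delta t)%:R * ((1 - delta) * muH)) by ring.
apply: lt_le_trans h1; rewrite -ltrBrDr; apply: lt_le_trans xS _.
by rewrite lerD2l lerN2; apply: le_trans h4 h2.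
Qed.

Lemma net_loss_ge_few delta t x w : 0 <= t ->
  (forall i, 0 <= Y i w) -> (forall i, 0 <= Z i w) ->
  x + c * t < Sy (n1 delta t) w ->
  [\/ x < net_loss Y Z c t w, t < Sz (n1 delta t) w | forall n, Sz n w <= t].
Proof.
move=> t0 Y0 Z0 xS.
have [[n [nt tn ->]]|[h _]] := net_loss_cases Y c Z0 t0; last by constructor 3.
have [n1n|nn1] := leqP (n1 delta t) n.
  constructor 1.
  have h1 : Sy (n1 delta t) w <= Sy n w by exact: partial_sum_mono.
  have h2 : c * Sz n w <= c * t by rewrite ler_pM2l.
  rewrite ltrBrDr; apply: lt_le_trans h1; apply: le_lt_trans xS.
  by rewrite lerD2l.
constructor 2; apply: lt_le_trans tn _.
exact: partial_sum_mono.
Qed.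

(** * Arbitrary dependence between claims and interarrival times *)

Section ComparableRange.
Context (Gamma : R).
Hypothesis Gamma0 : 0 < Gamma.

Let b0 : 0 < b. Proof. exact: drift_gt0. Qed.

Lemma tail_range a : 0 < a -> exists C : R, 0 < C /\
  forall t x, 0 <= t -> x <= Gamma * t -> tail G (a * t) <= C * tail G (x + b * t).
Proof.
move=> a0; have B0 : 0 < (Gamma + b) / a by rewrite divr_gt0// addr_gt0.
have [C [C0 hC]] := tail_scale_le CG B0.
exists C; split => // t x t0 xt.
apply: le_trans (hC _ _) _; first by rewrite mulr_ge0// ltW.
rewrite ler_pM2l//; apply: le_tail.
have -> : (Gamma + b) / a * (a * t) = Gamma * t + b * t.
  by field; rewrite !gt_eqF.
by rewrite lerD2r.
Qed.

Lemma late_negligible delta e : 0 < delta < 1 -> 0 < e ->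
  exists t0 : R, 0 < t0 /\ forall t x, t0 <= t -> x <= Gamma * t ->
    pr (late delta t) <= e * (t / muH * tail G (x + b * t)).
Proof.
move=> d01 e0; have /andP[d0 d1] := d01.
have d20 : 0 < 1 / 2 * delta by rewrite mulr_gt0// divr_gt0.
have [C [C0 hC]] := tail_range d20.
have [t0 [t00 h]] := late_small d01 (divr_gt0 e0 C0).
exists t0; split => // t x tt xt.
have tpos : 0 < t by apply: lt_le_trans tt.
apply: le_trans (h t tt) _.
have hx := hC t x (ltW tpos) xt.
have -> : 1 / 2 * (delta * t) = 1 / 2 * delta * t by ring.
have -> : e * (t / muH * tail G (x + b * t)) =
    e / C * (t / muH * (C * tail G (x + b * t))) by field; rewrite !gt_eqF.
by rewrite ler_pM2l ?divr_gt0// ler_pM2l ?divr_gt0.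
Qed.

Lemma early_negligible delta e : 0 < delta < 1 -> 0 < e ->
  exists t0 : R, 0 < t0 /\ forall t x, t0 <= t -> x <= Gamma * t ->
    pr (\bigcup_i early delta (n1 delta t + i)) <=
    e * (t / muH * tail G (x + b * t)).
Proof.
move=> d01 e0; have /andP[d0 d1] := d01.
have [C [k [C0 k0 hE]]] := early_exponential d0.
have omd : 0 < 1 - delta by rewrite subr_gt0.
pose q := expR (- k).
have q01 : 0 <= q < 1 by rewrite expR_ge0 /= expR_lt1 oppr_lt0.
have omq : 0 < 1 - q by rewrite subr_gt0; case/andP: q01.
pose a := (1 - delta) / muH.
have a0 : 0 < a by rewrite divr_gt0.
have [D [D0 hD]] := tail_range a0.
pose A := C * expR k / (1 - q).
have A0 : 0 < A by rewrite /A; pos.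
have [x0 [x00 hx]] := expRN_tail CG k0 (divr_gt0 e0 (mulr_gt0 A0 D0)).
exists (Num.max muH (x0 / a)); split; first by rewrite lt_max muH0.
move=> t x; rewrite ge_max => /andP[tm tx] xt.
have tpos : 0 < t by apply: lt_le_trans tm.
have xat : x0 <= a * t by rewrite mulrC -ler_pdivrMr.
have mE i : measurable (early delta i) by exact: measurable_Sz_lt.
have Cq : 0 <= C * q ^+ n1 delta t by rewrite mulr_ge0 ?exprn_ge0 ?expR_ge0// ltW.
apply: le_trans (@prob_bigcup_geometric _ _ _ P (fun n => early delta n) _ q
  (n1 delta t) mE Cq q01 _) _.
  by move=> i; rewrite -mulrA -exprD; exact: hE.
have qn : q ^+ n1 delta t <= expR k * expR (- (k * (a * t))).
  rewrite -expRM_natl -expRD ler_expR mulrN lerNl opprD opprK.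
  have /ltW := few_renewals_gt muH delta t; rewrite -(ler_pM2l k0).
  have -> : k * ((1 - delta) * (t / muH) - 1) = - k + k * (a * t).
    by rewrite /a; ring.
  by rewrite [k * _%:R]mulrC.
apply: le_trans (_ : A * expR (- (k * (a * t))) <= _).
  by rewrite /A [leRHS]mulrAC ler_pM2r ?invr_gt0// -mulrA ler_pM2l.
have := hx _ xat; rewrite -(ler_pM2l A0) => /le_trans; apply.
have -> : A * (e / (A * D) * tail G (a * t)) = e / D * tail G (a * t).
  by field; rewrite !gt_eqF.
apply: le_trans (_ : e / D * (D * tail G (x + b * t)) <= _).
  by rewrite ler_pM2l ?divr_gt0//; apply: hD => //; exact: ltW.
have -> : e / D * (D * tail G (x + b * t)) = e * (1 * tail G (x + b * t)).
  by field; rewrite gt_eqF.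
rewrite ler_pM2l// ler_wpM2r ?tail_ge0//.
by rewrite ler_pdivlMr// mul1r.
Qed.

Lemma loss_upper_comparable delta e : 0 < delta < 1 -> 0 < e ->
  exists t0 : R, 0 < t0 /\ forall t x, t0 <= t -> 0 <= x <= Gamma * t ->
    pr (loss x t) <=
    pr [set w | x + c * (1 - delta) * muH * (n1 delta t)%:R < Sy (n2 delta t) w] +
    e * (t / muH * tail G (x + b * t)).
Proof.
move=> d01 e0; have e20 : 0 < e / 2 by rewrite divr_gt0.
have [t1 [t10 h1]] := late_negligible d01 e20.
have [t2 [t20 h2]] := early_negligible d01 e20.
exists (Num.max t1 t2); split; first by rewrite lt_max t10.
move=> t x; rewrite ge_max => /andP[tt1 tt2] /andP[x0 xt].
have tpos : 0 < t by apply: lt_le_trans tt1.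
have mE : measurable (\bigcup_i early delta (n1 delta t + i)).
  by apply: bigcup_measurable => i _; exact: measurable_Sz_lt.
have mM := measurable_Sy_gt (n2 delta t)
  (x + c * (1 - delta) * muH * (n1 delta t)%:R).
have mL := measurable_Sz_gt (n1 delta t) t.
have mLE := measurableU _ _ mL mE.
set Main := [set w | _ < Sy _ w] in mM *.
apply: le_trans (_ : pr (Main `|` (late delta t `|`
    \bigcup_i early delta (n1 delta t + i))) <= _).
  apply: le_prob_model; [exact: measurable_loss|exact: measurableU|].
  move=> w Y0 Z0 /=.
  have [[n [nt tn ->]]|[_ ->]] := net_loss_cases Y c Z0 (ltW tpos); last first.
    by rewrite ltNge x0.
  move=> xS; have [n1n|nn1] := leqP (n1 delta t) n; last first.
    right; left => /=; apply: lt_le_trans tn _; exact: partial_sum_mono.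
  have [nE|nE] := ltP (Sz n w) (n%:R * (muH - delta * muH)).
    by right; right; exists (n - n1 delta t)%N => //=; rewrite subnKC.
  by left; exact: partial_sum_bracket nE.
apply: le_trans (probU_le _ mM mLE) _; rewrite lerD2l.
apply: le_trans (probU_le _ mL mE) _.
have -> : e * (t / muH * tail G (x + b * t)) = e / 2 * (t / muH * tail G (x + b * t)) +
  e / 2 * (t / muH * tail G (x + b * t)) by rewrite -mulrDl -splitr.
by apply: lerD; [exact: h1|exact: h2].
Qed.

Lemma loss_lower_comparable delta e : 0 < delta < 1 -> 0 < e ->
  exists t0 : R, 0 < t0 /\ forall t x, t0 <= t -> 0 <= x <= Gamma * t ->
    pr [set w | x + c * t < Sy (n1 delta t) w] <=
    pr (loss x t) + e * (t / muH * tail G (x + b * t)).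
Proof.
move=> d01 e0; have [t1 [t10 h1]] := late_negligible d01 e0.
exists t1; split => // t x tt /andP[x0 xt].
have tpos : 0 < t by apply: lt_le_trans tt.
have mL := measurable_Sz_gt (n1 delta t) t.
have mO := measurable_loss x t.
pose I0 := [set w | forall n, Sz n w <= t].
have mI : measurable I0 := measurable_infinitely t.
have mLI := measurableU _ _ mL mI.
apply: le_trans (_ : pr (loss x t `|` (late delta t `|` I0)) <= _).
  apply: le_prob_model; [exact: measurable_Sy_gt|exact: measurableU|].
  move=> w Y0 Z0 /= xS.
  by have [h|h|h] := net_loss_ge_few (ltW tpos) Y0 Z0 xS;
    [left|right; left|right; right].
apply: le_trans (probU_le _ mO mLI) _; rewrite lerD2l.
apply: le_trans (probU_le _ mL mI) _.
rewrite infinitely_many_null ?addr0; last exact: ltW.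
exact: h1.
Qed.

End ComparableRange.

(** * Independent claims and interarrival times *)

Section IndependentRange.
Context (gam : R).
Hypothesis gam0 : 0 < gam.
Hypothesis YZ : forall A B, measurable A -> measurable B ->
  generated_sigma (fun i => Y i : T -> R) A ->
  generated_sigma (fun i => Z i : T -> R) B ->
  pr (A `&` B) = pr A * pr B.

Let b0 : 0 < b. Proof. exact: drift_gt0. Qed.

Lemma tail_beyond a : 0 < a -> exists C : R, 0 < C /\
  forall t x, 0 <= t -> gam * t <= x -> tail G (a * x) <= C * tail G (x + b * t).
Proof.
move=> a0; have B0 : 0 < (1 + b / gam) / a.
  by rewrite divr_gt0// addr_gt0// divr_gt0.
have [C [C0 hC]] := tail_scale_le CG B0.
exists C; split => // t x t0 xt.
have x0 : 0 <= x by apply: le_trans xt; rewrite mulr_ge0// ltW.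
apply: le_trans (hC _ _) _; first by rewrite mulr_ge0// ltW.
rewrite ler_pM2l//; apply: le_tail.
have -> : (1 + b / gam) / a * (a * x) = x + b * (x / gam).
  by field; rewrite !gt_eqF.
by rewrite lerD2l ler_pM2l// ler_pdivlMr// mulrC.
Qed.

(** By independence the crude polynomial bound on the sum of [n] claims is
    multiplied by the probability, exponentially small in [n], that [n]
    interarrival times are too short; the products are summable over [n], and the
    rate has the additional factor [t]. *)
Lemma early_loss_negligible delta e : 0 < delta < 1 -> 0 < e ->
  exists t0 : R, 0 < t0 /\ forall t x, t0 <= t -> gam * t <= x ->
    pr (\bigcup_n (early delta n `&` [set w | x < Sy n w])) <=
    e * (t / muH * tail G (x + b * t)).
Proof.
move=> /andP[d0 d1] e0.
have [C [k [C0 k0 hE]]] := early_exponential d0.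
have [p hp] := partial_sum_crude YG CG ltr01 (tail_self G).
have k20 : 0 < k / 2 by rewrite divr_gt0.
have [D [D0 hD]] := expr_le_expR p.+1 k20.
pose q := expR (- (k / 2)).
have q01 : 0 <= q < 1 by rewrite expR_ge0 /= expR_lt1 oppr_lt0.
have omq : 0 < 1 - q by rewrite subr_gt0; case/andP: q01.
have [F [F0 hF]] := tail_beyond ltr01.
pose A := C * (2 ^+ p * D) / (1 - q) * F.
have A0 : 0 < A by rewrite /A; pos.
exists (A * muH / e); split; first by pos.
move=> t x tt xt.
have tpos : 0 < t by apply: lt_le_trans tt; pos.
have x0 : 0 <= x by apply: le_trans xt; rewrite mulr_ge0// ltW.
have mA n : measurable (early delta n `&` [set w | x < Sy n w]).
  by apply: measurableI; [exact: measurable_Sz_lt|exact: measurable_Sy_gt].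
pose B := C * (2 ^+ p * D) * tail G x.
have B0 : 0 <= B by rewrite /B mulr_ge0 ?tail_ge0// ltW//; pos.
apply: le_trans (@prob_bigcup_geometric _ _ _ P _ B q 0 mA B0 q01 _) _.
  move=> n; rewrite add0n setIC YZ; last 4 first.
  - exact: measurable_Sy_gt.
  - exact: measurable_Sz_lt.
  - exact: generated_sum_gt.
  - exact: generated_sum_lt.
  have hn : n%:R * (2 * n%:R) ^+ p <= 2 ^+ p * D * expR (k / 2 * n%:R).
    rewrite exprMn mulrCA -exprS -mulrA ler_pM2l ?exprn_gt0//.
    exact: hD.
  have qq : expR (- k) ^+ n * expR (k / 2 * n%:R) = q ^+ n.
    rewrite -!expRM_natl -expRD; congr expR.
    by rewrite {1}(splitr k); ring.
  apply: le_trans (_ : (2 ^+ p * D * expR (k / 2 * n%:R) * tail G x) *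
      (C * expR (- k) ^+ n) <= _).
    apply: ler_pM; rewrite ?prob_ge0//.
    apply: le_trans (hp x n x0) _; rewrite mul1r.
    by rewrite ler_wpM2r ?tail_ge0.
  rewrite /B -qq le_eqVlt; apply/orP; left; apply/eqP; ring.
rewrite /B mulrAC.
have hx := hF t x (ltW tpos) xt; rewrite mul1r in hx.
apply: le_trans (_ : A * tail G (x + b * t) <= _).
  rewrite /A -[_ * F * _]mulrA ler_pM2l//; pos.
rewrite mulrA ler_wpM2r ?tail_ge0// mulrA ler_pdivlMr//.
by move: tt; rewrite ler_pdivrMr// mulrC [t * e]mulrC.
Qed.

(** The bound has the order of the rate itself, uniformly in the number of claims,
    so that any independent factor that vanishes makes it negligible. *)
Lemma claims_linear_bound : exists x0 C : R, [/\ 0 < x0, 0 < C &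
  forall t x n, x0 <= x -> 0 <= t -> gam * t <= x -> n%:R <= t / muH ->
    pr [set w | n%:R * muG + x < Sy n w] <= C * (t / muH * tail G (x + b * t))].
Proof.
have th : 0 < (1 / 2 : R) < 1 by apply/andP; split; lra.
have [x0 [x00 h]] := large_deviation_upper YG Gpos Gmu muG0 MG0 YM CG Gpos Gmu ltr01
  (tail_self G) th (mulr_gt0 gam0 muH0) ltr01.
have a0 : 0 < 1 - 1 / 2 :> R by lra.
have [F [F0 hF]] := tail_beyond a0.
exists x0, (2 * F); split => //; first by rewrite mulr_gt0.
move=> t x n xx t0 xt nt.
have nx : gam * muH * n%:R <= x.
  by apply: le_trans xt; rewrite -mulrA ler_pM2l// mulrC -ler_pdivlMr.
apply: le_trans (h x n xx nx) _; set V := n%:R * tail G _.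
have -> : V + 1 * V = 2 * V by ring.
have -> : 2 * F * (t / muH * tail G (x + b * t)) =
  2 * (t / muH * (F * tail G (x + b * t))) by ring.
rewrite ler_pM2l//; apply: ler_pM => //; first exact: tail_ge0.
exact: hF.
Qed.

(** The events that exactly [n] renewals occurred are disjoint. *)
Lemma renewal_count_sum_le t m :
  \sum_(n < m) pr [set w | Sz n w <= t /\ t < Sz n.+1 w] <=
  pr [set w | t < Sz m w].
Proof.
elim: m => [|m IH]; first by rewrite big_ord0 prob_ge0.
rewrite big_ord_recr/=; apply: le_trans (lerD IH (lexx _)) _.
have mA := measurable_Sz_gt m t.
have mB : measurable [set w | Sz m w <= t /\ t < Sz m.+1 w].
  by apply: measurableI; [exact: measurable_Sz_le|exact: measurable_Sz_gt].
apply: le_trans (_ : pr ([set w | t < Sz m w] `|`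
    [set w | Sz m w <= t /\ t < Sz m.+1 w]) <= _).
  rewrite -lee_fin EFinD -!probE//; last exact: measurableU.
  rewrite measureU//; apply/seteqP; split => w //= [tm [mt _]].
  by move: tm; rewrite ltNge mt.
apply: (le_prob_nonneg ZH Hpos); [exact: measurableU|exact: measurable_Sz_gt|].
move=> w Z0 /= [tm|[]//]; apply: lt_le_trans tm _; exact: partial_sum_mono.
Qed.

Lemma loss_upper_independent delta e : 0 < delta < 1 -> 0 < e ->
  exists t0 : R, 0 < t0 /\ forall t x, t0 <= t -> gam * t <= x ->
    pr (loss x t) <=
    pr [set w | x + c * (1 - delta) * muH * (n1 delta t)%:R < Sy (n2 delta t) w] +
    e * (t / muH * tail G (x + b * t)).
Proof.
move=> d01 e0; have /andP[d0 d1] := d01.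
(* [rho] is so small that, on paths that are not [early rho], the premiums
   collected by the [n]-th renewal outweigh the mean of the [n] claims *)
pose rho := Num.min delta (1 - muG / (c * muH)).
have cm0 : 0 < c * muH by rewrite mulr_gt0.
have rho0 : 0 < rho by rewrite lt_min d0 subr_gt0 ltr_pdivrMr// mul1r.
have rhod : rho <= delta by rewrite ge_min lexx.
have rho01 : 0 < rho < 1 by rewrite rho0 (le_lt_trans rhod).
have rhoc : muG <= c * (muH - rho * muH).
  have : rho * (c * muH) <= (1 - muG / (c * muH)) * (c * muH).
    by rewrite ler_pM2r// ge_min lexx orbT.
  rewrite mulrBl divfK ?gt_eqF// mul1r => h.
  have -> : c * (muH - rho * muH) = c * muH - rho * (c * muH) by ring.
  by rewrite lerBrDr addrC -lerBrDr.
have e20 : 0 < e / 2 by rewrite divr_gt0.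
have [t1 [t10 h1]] := early_loss_negligible rho01 e20.
have [x0 [C [x00 C0 hC]]] := claims_linear_bound.
have [t2 [t20 h2]] := late_cvg0 d01 (divr_gt0 e20 C0).
exists (Num.max (x0 / gam) (Num.max t1 t2)); split.
  by rewrite lt_max divr_gt0.
move=> t x; rewrite !ge_max => /and3P[tt0 tt1 tt2] xt.
have tpos : 0 < t by apply: lt_le_trans tt1.
have xx0 : x0 <= x by apply: le_trans xt; rewrite mulrC -ler_pdivrMr.
have xpos : 0 <= x by apply: le_trans xx0; exact: ltW.
pose E := \bigcup_n (early rho n `&` [set w | x < Sy n w]).
have mE : measurable E.
  apply: bigcup_measurable => n _.
  by apply: measurableI; [exact: measurable_Sz_lt|exact: measurable_Sy_gt].
pose L n := [set w | n%:R * muG + x < Sy n w] `&`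
  [set w | Sz n w <= t /\ t < Sz n.+1 w].
have mN n : measurable [set w | Sz n w <= t /\ t < Sz n.+1 w].
  by apply: measurableI; [exact: measurable_Sz_le|exact: measurable_Sz_gt].
have mLn n : measurable (L n).
  by apply: measurableI => //; exact: measurable_Sy_gt.
have mL : measurable (\bigcup_(n < n1 delta t) L n) by exact: bigcup_measurable.
have mM := measurable_Sy_gt (n2 delta t)
  (x + c * (1 - delta) * muH * (n1 delta t)%:R).
set Main := [set w | _ < Sy _ w] in mM *.
have mEL := measurableU _ _ mE mL.
apply: le_trans (_ : pr (Main `|` (E `|` \bigcup_(n < n1 delta t) L n)) <= _).
  apply: le_prob_model; [exact: measurable_loss|exact: measurableU|].
  move=> w Y0 Z0 /=.
  have [[n [nt tn ->]]|[_ ->]] := net_loss_cases Y c Z0 (ltW tpos); last first.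
    by rewrite ltNge xpos.
  move=> xS.
  have Sz0 : 0 <= Sz n w by apply: sumr_ge0.
  have [nE|nE] := ltP (Sz n w) (n%:R * (muH - rho * muH)).
    right; left; exists n => //; split => //=.
    apply: lt_le_trans xS _; rewrite gerBl mulr_ge0// ltW//.
  have [n1n|nn1] := leqP (n1 delta t) n.
    left; apply: partial_sum_bracket xS n1n _ => //.
    apply: le_trans nE; apply: ler_wpM2l => //.
    by rewrite lerD2l lerN2 ler_pM2r.
  right; right; exists n => //; split => //=.
  rewrite addrC -ltrBrDr; apply: lt_le_trans xS _; rewrite lerD2l lerN2.
  apply: le_trans (_ : c * (n%:R * (muH - rho * muH)) <= _); last by rewrite ler_pM2l.
  by rewrite mulrCA ler_wpM2l.
apply: le_trans (probU_le _ mM mEL) _; rewrite lerD2l.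
apply: le_trans (probU_le _ mE mL) _.
set U := t / muH * tail G (x + b * t).
have U0 : 0 <= U by rewrite mulr_ge0 ?tail_ge0// divr_ge0// ltW.
rewrite [e]splitr mulrDl; apply: lerD; first exact: h1.
apply: le_trans (prob_bigcup_ord_le P _ mLn) _.
apply: le_trans (_ : \sum_(n < n1 delta t) C * U *
    pr [set w | Sz n w <= t /\ t < Sz n.+1 w] <= _).
  apply: ler_sum => n _; rewrite YZ //; last 3 first.
  - exact: measurable_Sy_gt.
  - exact: generated_sum_gt.
  - by apply: generated_sigmaI; [exact: generated_sum_le|exact: generated_sum_gt].
  apply: ler_wpM2r; first exact: prob_ge0.
  apply: hC => //; first exact: ltW.
  apply: le_trans (few_renewals_le1 muH0 d01 (ltW tpos)).
  by rewrite ler_nat ltnW.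
rewrite -mulr_sumr.
apply: le_trans (ler_wpM2l _ (le_trans (renewal_count_sum_le _ _) (h2 t tt2))) _.
  by rewrite mulr_ge0// ltW.
have -> // : C * U * (e / 2 / C) = e / 2 * U by field; rewrite gt_eqF.
Qed.

Lemma loss_lower_independent delta e : 0 < delta < 1 -> 0 < e ->
  exists t0 : R, 0 < t0 /\ forall t x, t0 <= t -> gam * t <= x ->
    pr [set w | x + c * t < Sy (n1 delta t) w] <=
    pr (loss x t) + e * (t / muH * tail G (x + b * t)).
Proof.
move=> d01 e0.
have [x0 [C [x00 C0 hC]]] := claims_linear_bound.
have [t2 [t20 h2]] := late_cvg0 d01 (divr_gt0 e0 C0).
exists (Num.max (x0 / gam) t2); split; first by rewrite lt_max divr_gt0.
move=> t x; rewrite ge_max => /andP[tt0 tt2] xt.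
have tpos : 0 < t by apply: lt_le_trans tt2.
have xx0 : x0 <= x by apply: le_trans xt; rewrite mulrC -ler_pdivrMr.
have mL := measurable_Sz_gt (n1 delta t) t.
have mO := measurable_loss x t.
pose I0 := [set w | forall n, Sz n w <= t].
have mI : measurable I0 := measurable_infinitely t.
pose S := [set w | x + c * t < Sy (n1 delta t) w].
have mS : measurable S by exact: measurable_Sy_gt.
have mSL := measurableI _ _ mS mL.
have mSLI := measurableU _ _ mSL mI.
apply: le_trans (_ : pr (loss x t `|` (S `&` late delta t `|` I0)) <= _).
  apply: le_prob_model; [exact: measurable_Sy_gt|exact: measurableU|].
  move=> w Y0 Z0 /= xS.
  by have [h|h|h] := net_loss_ge_few (ltW tpos) Y0 Z0 xS;
    [left|right; left|right; right].
apply: le_trans (probU_le _ mO mSLI) _; rewrite lerD2l.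
apply: le_trans (probU_le _ mSL mI) _.
rewrite infinitely_many_null ?addr0; last exact: ltW.
rewrite YZ //; last 2 first.
- exact: generated_sum_gt.
- exact: generated_sum_gt.
have hS : pr S <= C * (t / muH * tail G (x + b * t)).
  have n1t := few_renewals_le1 muH0 d01 (ltW tpos).
  apply: le_trans (hC t x (n1 delta t) xx0 (ltW tpos) xt n1t).
  apply: le_prob => //; first exact: measurable_Sy_gt.
  move=> w /=; apply: le_lt_trans; rewrite addrC lerD2l.
  apply: le_trans (_ : t / muH * muG <= _); first by rewrite ler_pM2r.
  by rewrite mulrAC ler_pdivrMr// [c * t]mulrC -mulrA ler_pM2l// ltW.
apply: le_trans (ler_pM _ _ hS (h2 t tt2)) _; rewrite ?prob_ge0//.
have -> // : C * (t / muH * tail G (x + b * t)) * (e / C) =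
  e * (t / muH * tail G (x + b * t)) by field; rewrite !gt_eqF.
Qed.

End IndependentRange.

End RenewalModel.

Lemma ratio_near1 (R : realType) (p r e : R) : 0 < r ->
  p <= (1 + e / 2) * r + e / 2 * r -> (1 - e / 2) * r <= p + e / 2 * r ->
  `|p / r - 1| <= e.
Proof.
move=> r0 up low; rewrite ler_norml; apply/andP; split.
  by rewrite lerBrDr ler_pdivlMr//; lra.
by rewrite lerBlDr ler_pdivrMr//; lra.
Qed.

Section UniformRatio.
Context d (T : measurableType d) (R : realType) (P : probability T R).
Context (Y Z : nat -> {RV P >-> R}) (G : probability R R).
Context (muG muH c MG : R).
Local Notation pr := (prob P).
Hypothesis YG : common_distribution Y G.
Hypothesis Gpos : nonneg_supported G.
Hypothesis Gmu : has_mean G muG.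
Hypothesis muG0 : 0 < muG.
Hypothesis muH0 : 0 < muH.
Hypothesis c0 : 0 < c.
Hypothesis load : muG < c * muH.
Hypothesis MG0 : 0 < MG.
Hypothesis YM : ENOD Y MG.
Hypothesis CG : consistently_varying G.

Local Notation b := (c - muG / muH).
Local Notation rate t x := (t / muH * tail G (x + b * t)).

(** The range of [x] only enters through the two comparisons of the net loss
    with sums of a deterministic number of claims. *)
Lemma deviation_ratio_cvg (A : R -> set R) :
  (forall t, 0 < t -> A t !=set0) -> (forall t x, 0 < t -> A t x -> 0 <= x) ->
  (forall delta e, 0 < delta < 1 -> 0 < e -> exists t0 : R, 0 < t0 /\
     forall t x, t0 <= t -> A t x -> pr [set w | x < net_loss Y Z c t w] <=
       pr [set w | x + c * (1 - delta) * muH * (few_renewals muH delta t)%:R <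
                   \sum_(i < many_renewals muH delta t) Y i w] + e * rate t x) ->
  (forall delta e, 0 < delta < 1 -> 0 < e -> exists t0 : R, 0 < t0 /\
     forall t x, t0 <= t -> A t x ->
       pr [set w | x + c * t < \sum_(i < few_renewals muH delta t) Y i w] <=
       pr [set w | x < net_loss Y Z c t w] + e * rate t x) ->
  ereal_sup [set `|deviation_ratio Y Z c G muG muH t x - 1|%:E | x in A t]
    @[t --> +oo] --> 0%E.
Proof.
move=> A0 Apos hup hlow.
have main e : 0 < e -> exists t0 : R, 0 < t0 /\ forall t x, t0 <= t -> A t x ->
    `|deviation_ratio Y Z c G muG muH t x - 1| <= e.
  move=> e0; have e20 : 0 < e / 2 by rewrite divr_gt0.
  have [d1 [d10 h1]] := claims_upper YG Gpos Gmu muG0 muH0 c0 load MG0 YM CG e20.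
  have [d2 [d20 h2]] := claims_lower YG Gpos Gmu muG0 muH0 load MG0 YM CG e20.
  pose delta := Num.min (1 / 2) (Num.min d1 d2).
  have dl0 : 0 < delta by rewrite !lt_min divr_gt0// d10.
  have dl1 : delta <= d1 by rewrite /delta !ge_min lexx !orbT.
  have dl2 : delta <= d2 by rewrite /delta !ge_min lexx !orbT.
  have dlh : delta <= 1 / 2 by rewrite ge_min lexx.
  have dl01 : 0 < delta < 1 by rewrite dl0/=; apply: le_lt_trans dlh _; lra.
  have [] := h1 delta; first by rewrite dl0.
  move=> t1 [t10 {}h1].
  have [] := h2 delta; first by rewrite dl0.
  move=> t2 [t20 {}h2].
  have [t3 [t30 h3]] := hup delta _ dl01 e20.
  have [t4 [t40 h4]] := hlow delta _ dl01 e20.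
  exists (Num.max (Num.max t1 t2) (Num.max t3 t4)); split.
    by rewrite !lt_max t10.
  move=> t x; rewrite !ge_max => /andP[/andP[tt1 tt2] /andP[tt3 tt4]] Ax.
  have tpos : 0 < t by apply: lt_le_trans tt1.
  have x0 := Apos t x tpos Ax.
  have up := le_trans (h3 t x tt3 Ax) (lerD (h1 t x tt1 x0) (lexx _)).
  have low := le_trans (h2 t x tt2 x0) (h4 t x tt4 Ax).
  rewrite /deviation_ratio.
  have -> : x - muG * muH^-1 * t + c * t = x + b * t by ring.
  have -> : muH^-1 * t = t / muH by rewrite mulrC.
  have r0 : 0 < rate t x.
    by rewrite mulr_gt0 ?consistently_varying_gt0// divr_gt0.
  rewrite -[fine _]/(pr [set w | x < net_loss Y Z c t w]).
  exact: ratio_near1 r0 up low.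
set S := fun t => ereal_sup _.
have bounds e : 0 < e -> exists t0 : R, 0 < t0 /\ forall t, t0 <= t ->
    (0%E <= S t <= e%:E)%E.
  move=> e0; have [t0 [t00 h]] := main e e0.
  exists t0; split => // t tt; apply/andP; split.
    have [x Ax] := A0 t (lt_le_trans t00 tt).
    apply: le_ereal_sup_tmp; eexists; first by exists x.
    by rewrite lee_fin.
  by apply: ge_ereal_sup => _ [x Ax <-]; rewrite lee_fin h.
apply/fine_cvgP; split.
  have [t0 [_ h]] := bounds 1 ltr01.
  exists t0; split; first exact: num_real.
  move=> t /= /ltW/h /andP[h0 h1].
  rewrite fin_real// (lt_le_trans _ h0)//=.
  by rewrite (le_lt_trans h1)// ltry.
apply/cvgrPdist_le => e e0; have [t0 [_ h]] := bounds e e0.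
exists t0; split; first exact: num_real.
move=> t /= /ltW/h /andP[h0 h1].
rewrite sub0r normrN ger0_norm; last exact: fine_ge0.
rewrite -lee_fin fineK// fin_real// (lt_le_trans _ h0)//=.
by rewrite (le_lt_trans h1)// ltry.
Qed.

End UniformRatio.

Theorem theorem1p3 (d : measure_display) (T : measurableType d) (R : realType)
    (P : probability T R)
    (Y Z : nat -> {RV P >-> R}) (tau : {RV P >-> R})
    (G H : probability R R) (muG muH c MG MH : R) :
  common_distribution Y G -> nonneg_supported G ->
  has_mean G muG -> 0 < muG ->
  common_distribution Z H -> nonneg_supported H ->
  has_mean H muH -> 0 < muH ->
  {ae P, forall w, 0 <= tau w} ->
  ereal_inf [set t%:E | t in [set t : R |
    0 <= t /\ (0 < renewal_mean Z t < +oo)%E]] = 0%E ->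
  0 < c -> muG < c * muH ->
  0 < MG -> ENOD Y MG -> consistently_varying G ->
  0 < MH -> ENOD Z MH ->
  tail H x / tail G x @[x --> +oo] --> 0 ->
  (case1 Y Z tau ->
     forall gamma : R, muG < gamma ->
     ereal_sup [set `|deviation_ratio Y Z c G muG muH t x - 1|%:E
               | x in [set x : R | gamma * t <= x]]
       @[t --> +oo] --> 0%E) /\
  (case2 Y Z tau ->
     forall gamma Gamma : R, muG < gamma -> gamma < Gamma ->
     ereal_sup [set `|deviation_ratio Y Z c G muG muH t x - 1|%:E
               | x in [set x : R | gamma * t <= x <= Gamma * t]]
       @[t --> +oo] --> 0%E).
Proof.
move=> YG Gpos Gmu muG0 ZH Hpos Hmu muH0 _ _ c0 load MG0 YM CG MH0 ZM HG.
split=> [ind gam gamG|_ gam Gam gamG gamGam].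
  have gam0 : 0 < gam by apply: lt_trans gamG.
  have YZ := fun A B => @case1_independent _ _ _ _ _ _ _ A B ind.
  apply: (deviation_ratio_cvg YG Gpos Gmu muG0 muH0 c0 load MG0 YM CG
    (A := fun t => [set x | gam * t <= x])).
  - by move=> t _; exists (gam * t) => /=.
  - by move=> t x t0 /=; apply: le_trans; rewrite mulr_ge0// ltW.
  - exact: (loss_upper_independent YG Gpos Gmu muG0 ZH Hpos Hmu muH0 c0 load
      MG0 YM CG MH0 ZM HG gam0 YZ).
  - exact: (loss_lower_independent YG Gpos Gmu muG0 ZH Hpos Hmu muH0 c0 load
      MG0 YM CG MH0 ZM HG gam0 YZ).
have gam0 : 0 < gam by apply: lt_trans gamG.
have Gam0 : 0 < Gam by apply: lt_trans gamGam.
have pos t x : 0 < t -> gam * t <= x <= Gam * t -> 0 <= x <= Gam * t.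
  by move=> t0 /andP[h ->]; rewrite andbT (le_trans _ h)// mulr_ge0// ltW.
apply: (deviation_ratio_cvg YG Gpos Gmu muG0 muH0 c0 load MG0 YM CG
  (A := fun t => [set x | gam * t <= x <= Gam * t])).
- by move=> t t0; exists (gam * t) => /=; rewrite lexx ler_pM2r// ltW.
- by move=> t x t0 /(pos t x t0)/andP[].
- move=> delta e d01 e0.
  have [t0 [t00 h]] := loss_upper_comparable YG Gpos Gmu ZH Hpos Hmu muH0 c0
    load CG MH0 ZM HG Gam0 d01 e0.
  exists t0; split => // t x tt /(pos t x (lt_le_trans t00 tt)); exact: h.
- move=> delta e d01 e0.
  have [t0 [t00 h]] := loss_lower_comparable YG Gpos Gmu ZH Hpos Hmu muH0 c0
    load CG MH0 ZM HG Gam0 d01 e0.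
  exists t0; split => // t x tt /(pos t x (lt_le_trans t00 tt)); exact: h.
Qed.
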